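(* For every integer $n\ge 1$ the following hold. (I) Let $Y_n\in\mathbb F_2[e_1,e_3,e_7,\dots]$ be the reduction modulo $2$ of the expression of $G_n=\bigl(p_{2^n-1}^2-p_{2(2^n-1)}\bigr)/2$ as an integer polynomial in the elementary symmetric functions $e_1,e_2,e_3,\dots$, after discarding all monomials which contain some $e_i$ with $i$ not of the form $2^k-1$. Then $Y_n=X_n^2$, where $X_n$ and $f_k$ are the elements of $\mathbb F_2[e_1,e_3,e_7,\dots]$ defined recursively by $$X_n=\sum_{k=0}^{n-2} e_{2^{n-k}-1}^{2^k}\, f_k,\qquad f_0=1,\qquad f_{k+1}=f_k e_1^{2^k}+X_{k+1}\quad (k\ge 0)$$ (an empty sum is zero, so $X_1=0$). Equivalently, with the convention $X_0:=1$, $$X_n=\sum_{k=0}^{n-2} e_{2^{n-k}-1}^{2^k}\Bigl(\sum_{j=0}^{k} e_1^{2^{k-1}+2^{k-2}+\cdots+2^j}X_j\Bigr),$$ where for $j=k$ the exponent of $e_1$ is $0$. (II) If one substitutes $1/D_i$ for $e_{2^i-1}$ and $1/L_i$ for $f_i$ in the formula $X_n=\sum_{k=0}^{n-2} e_{2^{n-k}-1}^{2^k} f_k$, one obtains $A_n$; that is, in $\mathbb F_2(t)$, $$\sum_{k=0}^{n-2}\frac{1}{D_{n-k}^{2^k}L_k}=A_n:=\frac{[n-1]}{L_n[1]^{2^{n-1}}}.$$ (III) In the field $\mathbb F_2((1/t))$, $$\sum_{\wp}\frac{1}{1-\wp^{2^n-1}}=\frac{[n-1]^2}{[1]^{2^n}},$$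 where $\wp$ runs over all (monic) irreducible polynomials of positive degree in $\mathbb F_2[t]$.
   Context: Here $q=2$. For $i\ge 0$, $[i]:=t^{2^i}-t\in\mathbb F_2[t]$ (so $[0]=0$), $D_0=L_0=1$, and for $i\ge1$, $D_i=\prod_{j=0}^{i-1}(t^{2^i}-t^{2^j})$ and $L_i=\prod_{j=1}^{i}[j]$. $p_m=\sum_i x_i^m$ denotes the $m$-th power sum and $e_i$ the $i$-th elementary symmetric function in variables $x_1,x_2,\dots$ (infinitely many, or sufficiently many so that the $e_i$ involved are algebraically independent). $G_n=(p_{2^n-1}^2-p_{2(2^n-1)})/2$ is the second elementary symmetric function of the $x_i^{2^n-1}$, hence a polynomial with integer coefficients in the $e_i$. The infinite sum in (III) converges in $\mathbb F_2((1/t))$, the completion of $\mathbb F_2(t)$ at the place $\infty$. *)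

(* Defs.v *)
From HB Require Import structures.
From mathcomp Require Import all_boot all_order all_algebra.
From mathcomp Require Import finmap mpoly.
From mathcomp Require boolp.

Set Implicit Arguments.
Unset Strict Implicit.
Unset Printing Implicit Defensive.

Import GRing.Theory.
Local Open Scope ring_scope.

(* Here [eps k] stands for e_{2^k - 1}, in an arbitrary commutative ring: the *)
(* same formula is used with polynomial variables and with the values 1/D_k.  *)

Section Recursion.
Variable R : comNzRingType.
Implicit Types eps f : nat -> R.

(* The index k runs over 0, ..., n - 2. *)
Definition Xformula eps f (n : nat) : R :=
  \sum_(k < n.-1) eps (n - k)%N ^+ (2 ^ k) * f k.

(* [fseq eps k] is the list f_0, ..., f_k; it makes the course-of-values      *)
(* recursion structural. See [fpoly0], [fpolyS] and [XpolyE].                 *)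
Fixpoint fseq eps (k : nat) : seq R :=
  if k is k'.+1 then
    let s := fseq eps k' in
    rcons s (s`_k' * eps 1%N ^+ (2 ^ k') + Xformula eps (fun i => s`_i) k)
  else [:: 1].

Definition fpoly eps (k : nat) : R := (fseq eps k)`_k.

Definition Xpoly eps (n : nat) : R :=
  if n is 0 then 1 else Xformula eps (fpoly eps) n.

Lemma size_fseq eps k : size (fseq eps k) = k.+1.
Proof. by elim: k => //= k IHk; rewrite size_rcons IHk. Qed.

Lemma nth_fseq eps k i : (i <= k)%N -> (fseq eps k)`_i = fpoly eps i.
Proof.
elim: k => [|k IHk]; first by case: i.
rewrite leq_eqVlt => /predU1P[-> //|ltik].
by rewrite /= nth_rcons size_fseq ltik IHk.
Qed.

Lemma fpoly0 eps : fpoly eps 0 = 1. Proof. by []. Qed.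

Lemma XpolyE eps n :
  (0 < n)%N -> Xpoly eps n = Xformula eps (fpoly eps) n.
Proof. by case: n. Qed.

Lemma fpolyS eps k :
  fpoly eps k.+1 = fpoly eps k * eps 1%N ^+ (2 ^ k) + Xpoly eps k.+1.
Proof.
rewrite {1}/fpoly /= nth_rcons size_fseq ltnn eqxx; congr (_ + _).
by apply: eq_bigr => i _; rewrite nth_fseq // ltnW.
Qed.

End Recursion.

(* The variable 'X_i of index i : 'I_N is x_{i+1} in [psum] and [Gpoly], and  *)
(* e_{i+1} in the argument P of [expresses] and [Ypoly].                      *)

Definition psum (N m : nat) : {mpoly int[N]} := \sum_(i < N) 'X_i ^+ m.

Definition Gpoly (N n : nat) : {mpoly int[N]} :=
  \sum_(i < N) \sum_(j < N | (i < j)%N)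
     'X_i ^+ (2 ^ n - 1) * 'X_j ^+ (2 ^ n - 1).

Lemma Gpoly_double N n :
  Gpoly N n *+ 2 = psum N (2 ^ n - 1) ^+ 2 - psum N (2 * (2 ^ n - 1)).
Proof.
rewrite /Gpoly /psum; set m := (2 ^ n - 1)%N; apply/esym/eqP.
rewrite subr_eq; apply/eqP; rewrite expr2 big_distrlr /=.
set y : 'I_N -> {mpoly int[N]} := fun i => 'X_i ^+ m.
have -> : \sum_(i < N) \sum_(j < N) y i * y j =
    \sum_(i < N) \sum_(j < N | (i < j)%N) y i * y j +
    \sum_(i < N) \sum_(j < N | (j < i)%N) y i * y j + \sum_(i < N) y i * y i.
  rewrite -!big_split /=; apply: eq_bigr => i _.
  rewrite (bigID (fun j : 'I_N => (i < j)%N)) /= -addrA; congr (_ + _).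
  rewrite (bigD1 i) ?ltnn //= addrC; congr (_ + _); apply: eq_bigl => j.
  by rewrite -leqNgt ltn_neqAle andbC -val_eqE.
rewrite [X in _ + X + _](exchange_big_dep xpredT) //= mulr2n; congr (_ + _ + _).
  by apply: eq_bigr => i _; apply: eq_bigr => j _; rewrite mulrC.
by apply: eq_bigr => i _; rewrite /y -exprD addnn mul2n.
Qed.

Definition expresses (N : nat) (P G : {mpoly int[N]}) : Prop :=
  P \mPo [tuple mesym N int i.+1 | i < N] = G.

Definition mersenne (i : nat) : bool := [exists k : 'I_i.+1, i == 2 ^ k - 1]%N.

Definition mersenne_mon (N : nat) (m : 'X_{1..N}) : bool :=
  [forall i : 'I_N, (m i != 0)%N ==> mersenne i.+1].

Definition Ypoly (N : nat) (P : {mpoly int[N]}) : {mpoly 'F_2[N]} :=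
  let Q := map_mpoly (intr : int -> 'F_2) P in
  \sum_(m <- msupp Q | mersenne_mon m) Q@_m *: 'X_[m].

(* The variable e_i of F_2[e_1, ..., e_N]; it is 0 unless 1 <= i <= N. *)
Definition evar (N i : nat) : {mpoly 'F_2[N]} :=
  \sum_(j < N | j.+1 == i) 'X_j.

Definition eps_var (N k : nat) : {mpoly 'F_2[N]} := evar N (2 ^ k - 1).

(* In F_2[t] and F_2(t), the indeterminate t is 'X; [brk i] is t^(2^i) - t.   *)

Notation F2t := {fraction {poly 'F_2}}.

Definition brk (i : nat) : {poly 'F_2} := 'X^(2 ^ i) - 'X.
Definition Dpoly (i : nat) : {poly 'F_2} :=
  \prod_(j < i) ('X^(2 ^ i) - 'X^(2 ^ j)).
Definition Lpoly (i : nat) : {poly 'F_2} := \prod_(1 <= j < i.+1) brk j.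

Definition Dfrac (i : nat) : F2t := tofrac (Dpoly i).
Definition Lfrac (i : nat) : F2t := tofrac (Lpoly i).

Definition A_ (n : nat) : F2t :=
  tofrac (brk n.-1) / (Lfrac n * tofrac (brk 1) ^+ (2 ^ n.-1)).

(* The ring R[[u]] of formal power series, by coefficients. F_2((1/t)) is the *)
(* fraction field of F_2[[u]], with u = 1/t.                                  *)

Record fps (R : Type) := Fps { fcoef : nat -> R }.

Lemma fpsP (R : Type) (a b : fps R) : fcoef a =1 fcoef b -> a = b.
Proof. by case: a b => [a] [b] /= /boolp.funext ->. Qed.

HB.instance Definition _ (R : Type) := boolp.gen_eqMixin (fps R).
HB.instance Definition _ (R : Type) := boolp.gen_choiceMixin (fps R).

Section FpsZmod.
Variable R : zmodType.
Implicit Types a b c : fps R.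

Definition fps0 : fps R := Fps (fun=> 0).
Definition fps_opp a : fps R := Fps (fun n => - fcoef a n).
Definition fps_add a b : fps R := Fps (fun n => fcoef a n + fcoef b n).

Fact fps_addA : associative fps_add.
Proof. by move=> a b c; apply: fpsP => n; apply: addrA. Qed.
Fact fps_addC : commutative fps_add.
Proof. by move=> a b; apply: fpsP => n; apply: addrC. Qed.
Fact fps_add0 : left_id fps0 fps_add.
Proof. by move=> a; apply: fpsP => n; apply: add0r. Qed.
Fact fps_addN : left_inverse fps0 fps_opp fps_add.
Proof. by move=> a; apply: fpsP => n; apply: addNr. Qed.

HB.instance Definition _ :=
  GRing.isZmodule.Build (fps R) fps_addA fps_addC fps_add0 fps_addN.
End FpsZmod.

Section FpsRing.
Variable R : comNzRingType.
Implicit Types a b c : fps R.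

Definition fpsC (x : R) : fps R := Fps (fun n => if n == 0%N then x else 0).
Definition fpsX : fps R := Fps (fun n => (n == 1%N)%:R).
Definition fps_mul a b : fps R :=
  Fps (fun n => \sum_(i < n.+1) fcoef a i * fcoef b (n - i)%N).

Definition ftrunc (n : nat) a : {poly R} := \poly_(i < n.+1) fcoef a i.

Lemma coef_ftrunc n a i : (i <= n)%N -> (ftrunc n a)`_i = fcoef a i.
Proof. by move=> lein; rewrite coef_poly ltnS lein. Qed.

Lemma fcoef_mul n m a b : (n <= m)%N ->
  fcoef (fps_mul a b) n = (ftrunc m a * ftrunc m b)`_n.
Proof.
move=> lenm; rewrite coefM; apply: eq_bigr => i _.
by rewrite !coef_ftrunc ?(leq_trans _ lenm) ?leq_subr // -ltnS.
Qed.

Fact fps_mulC : commutative fps_mul.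
Proof.
by move=> a b; apply: fpsP => n; rewrite !(fcoef_mul _ _ (leqnn n)) mulrC.
Qed.

Fact fps_mulA : associative fps_mul.
Proof.
move=> a b c; apply: fpsP => n.
transitivity ((ftrunc n a * (ftrunc n b * ftrunc n c))`_n).
  rewrite coefM; apply: eq_bigr => i _.
  by rewrite coef_ftrunc -1?ltnS // -fcoef_mul ?leq_subr.
rewrite mulrA coefM; apply: eq_bigr => i _.
by rewrite coef_ftrunc ?leq_subr // -fcoef_mul // -ltnS.
Qed.

Fact fps_mul1 : left_id (fpsC 1) fps_mul.
Proof.
move=> a; apply: fpsP => n /=; rewrite big_ord_recl /= mul1r subn0.
by rewrite big1 ?addr0 // => i _; rewrite mul0r.
Qed.

Fact fps_mulDl : left_distributive fps_mul +%R.
Proof.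
move=> a b c; apply: fpsP => n /=; rewrite -big_split /=.
by apply: eq_bigr => i _; rewrite mulrDl.
Qed.

Fact fps_oner_neq0 : fpsC 1 != 0.
Proof.
by apply/eqP => /(congr1 (fun a => fcoef a 0)) /= /eqP; rewrite oner_eq0.
Qed.

HB.instance Definition _ := GRing.Zmodule_isComNzRing.Build (fps R)
  fps_mulA fps_mulC fps_mul1 fps_mulDl fps_oner_neq0.

Fact fpsC_is_zmod_morphism : zmod_morphism fpsC.
Proof. by move=> x y; apply: fpsP => -[|n] /=; rewrite ?subr0. Qed.
HB.instance Definition _ :=
  GRing.isZmodMorphism.Build R (fps R) fpsC fpsC_is_zmod_morphism.

Fact fpsC_is_monoid_morphism : monoid_morphism fpsC.
Proof.
split=> // x y; apply: fpsP => n /=; rewrite big_ord_recl /= subn0 big1.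
  by rewrite addr0; case: n => //= n; rewrite mulr0.
by move=> i _; rewrite mul0r.
Qed.
HB.instance Definition _ :=
  GRing.isMonoidMorphism.Build R (fps R) fpsC fpsC_is_monoid_morphism.

(* Classical choice of an inverse, when there is one. *)
Definition fps_unit : pred (fps R) :=
  fun a => boolp.asbool (exists b, b * a = 1).
Definition fps_inv a : fps R :=
  if boolp.pselect (exists b, b * a = 1) is left ex_b
  then projT1 (boolp.constructive_indefinite_description ex_b) else a.

Fact fps_mulV : {in fps_unit, left_inverse 1 fps_inv *%R}.
Proof.
move=> a /boolp.asboolP ua; rewrite /fps_inv.
case: boolp.pselect => // ex_b.
by case: boolp.constructive_indefinite_description.
Qed.
Fact fps_unitP a b : b * a = 1 -> fps_unit a.
Proof. by move=> ba1; apply/boolp.asboolP; exists b. Qed.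
Fact fps_inv_out : {in [predC fps_unit], fps_inv =1 id}.
Proof.
move=> a /boolp.asboolP ua; rewrite /fps_inv.
by case: boolp.pselect.
Qed.
HB.instance Definition _ := GRing.ComNzRing_hasMulInverse.Build (fps R)
  fps_mulV fps_unitP fps_inv_out.
End FpsRing.

Section FpsDomain.
Variable R : idomainType.

Lemma fps_order (a : fps R) : a != 0 ->
  exists2 n, fcoef a n != 0 & forall i, (i < n)%N -> fcoef a i = 0.
Proof.
move=> a_neq0; have /ex_minnP[n an_neq0 min_n] : exists n, fcoef a n != 0.
  apply/boolp.not_existsP => a0; move/eqP: a_neq0; apply; apply: fpsP => n.
  by apply/eqP; move/negP: (a0 n); rewrite negbK.
exists n => // i ltin; apply/eqP; apply: contraTT ltin => /min_n.
by rewrite -leqNgt.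
Qed.

Fact fps_integral : GRing.integral_domain_axiom (fps R).
Proof.
move=> a b ab0; rewrite -[_ || _]negbK negb_or; apply/negP => /andP[].
move=> /fps_order[n an_neq0 lt_n] /fps_order[m bm_neq0 lt_m].
move/(congr1 (fun c => fcoef c (n + m)%N)): ab0 => /=.
have ltn_nm : (n < (n + m).+1)%N by rewrite ltnS leq_addr.
rewrite (bigD1 (Ordinal ltn_nm)) //= addKn big1 ?addr0 => [/eqP|i].
  by rewrite mulf_eq0 (negPf an_neq0) (negPf bm_neq0).
rewrite -val_eqE /= neq_ltn => /orP[/lt_n -> | ltni]; first by rewrite mul0r.
by rewrite lt_m ?mulr0 // ltn_subLR ?ltn_add2r // -ltnS.
Qed.
HB.instance Definition _ :=
  GRing.ComUnitRing_isIntegral.Build (fps R) fps_integral.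
End FpsDomain.

Notation F2Laurent := {fraction fps 'F_2}.

Definition u_inf : F2Laurent := tofrac (fpsX 'F_2).
Definition constL (c : 'F_2) : F2Laurent := tofrac (fpsC c).
HB.instance Definition _ :=
  GRing.RMorphism.copy constL (@tofrac _ \o @fpsC 'F_2).

(* The inclusion of F_2[t] in F_2((1/t)): evaluation at t = 1/u. *)
Definition toL (p : {poly 'F_2}) : F2Laurent := (map_poly constL p).[u_inf^-1].

(* Unconditional summability over the index set [P] for the (1/t)-adic        *)
(* topology, the sets u^M F_2[[u]] being a basis of neighbourhoods of 0.      *)
Definition has_sumL (I : choiceType) (P : I -> Prop) (F : I -> F2Laurent)
    (s : F2Laurent) : Prop :=
  forall M : nat, exists S0 : {fset I},
    (forall i, i \in S0 -> P i) /\
    forall S : {fset I}, (forall i, i \in S -> P i) -> (S0 `<=` S)%fset ->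
      exists g : fps 'F_2,
        \sum_(i <- S) F i - s = u_inf ^+ M * tofrac g.

(* Main.v *)
(* The proof rests on two identities for a finite subgroup V of a field of    *)
(* characteristic 2. Put f_n = sum over nonzero v of v^-(2^n - 1).            *)
(* - The second elementary symmetric function of the v^-(2^n - 1) is X^2,     *)
(*   where X = f_n + f_(n-1) f_1^(2^(n-1)) is the sum of v / (vw)^(2^(n-1))   *)
(*   over ordered pairs of distinct nonzero v, w: the difference is a sum     *)
(*   over triples {v, w, v + w} that vanishes.                                *)
(* - If V is the union of a subgroup and its coset Y, a similar cancellation  *)
(*   expresses the sum of y^-(2^n - 1) over Y by f_(n-1) and the sum of 1/y.  *)
(*                                                                            *)
(* (I) Over an algebraic closure of F_2, specialize the e_i so that only the  *)
(* e_(2^k - 1) survive: the nonzero variables x are then the inverses of the  *)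
(* nonzero roots of an additive polynomial, i.e. of a finite group V. By      *)
(* Newton's identities the f_n of V satisfy the recursion defining the f_k,   *)
(* hence X = X_n, and both sides of Y_n = X_n^2 agree at every point.         *)
(*                                                                            *)
(* (II) As D_i = [i] D_(i-1)^2, L_i = L_(i-1) [i] and                         *)
(* [n] = [n-k]^(2^k) + [k], the sum of the 1/(D_(n-k)^(2^k) L_k) over         *)
(* 0 <= k <= n, multiplied by [n], is twice another sum, hence zero.          *)
(*                                                                            *)
(* (III) If all products of B and C are distinct, e_2 / p_1^2 of the set of   *)
(* products is, in characteristic 2, the sum of its values on B and C. Unique *)
(* factorization and the value 1/(P^m - 1) for the geometric series of P^-m,  *)
(* m = 2^n - 1, show that the sum over primes is e_2 / p_1^2 of the values    *)
(* c^-m, c monic. By the first identity it is (X / f_n)^2 for V = F_2[t], and *)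
(* the second one gives X / f_n = [n-1] / [1]^(2^(n-1)), because {deg <= d} = *)
(* t {deg < d} + F_2. Everything is done at finite level d, up to an error in *)
(* the d-th power of the maximal ideal.                                       *)

Require Import Defs.
From HB Require Import structures.
From mathcomp Require Import all_boot all_order all_algebra.
From mathcomp Require Import finmap mpoly.
From mathcomp Require Import closed_field separable.
From mathcomp Require Import ring zify qpoly perm.
Set Implicit Arguments.
Unset Strict Implicit.
Unset Printing Implicit Defensive.
Import GRing.Theory.
Local Open Scope ring_scope.

(** * Pair sums over finite additive groups *)

(** Parts (I) and (III) rest on one fact about a finite additive group V in characteristic 2: e_2 of
    the v^-(2^n - 1), over nonzero v, is the square of [pairX] ([e2_invpower]), and [pairX] is f_n +
    f_(n-1) f_1^(2^(n-1)) in the reciprocal power sums of V ([pairXE]).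

    For (I), every choice of the e_(2^k - 1) in an algebraically closed field comes from such a V,
    the roots of X times [mersenne_poly] ([mersenne_poly_roots]). Newton's identities and inversion
    of Frobenius-twisted power series ([newton_mersenne], [twmul_inv]) show that the power sums of V
    obey the recursion of the f_k; [mpoly_eq0_closed_field] goes back from points to polynomials.

    For (III), V consists of the polynomials of degree at most D. In characteristic 2 the ratio e_2
    / p_1^2 is additive over product sets ([e2_allpairs]), so unique factorization makes it a sum
    over primes up to a small error ([sieve_e2]); the coset identity [invpsum_coset] gives [pairX] /
    f_n in the limit ([prime_sum_estimate]).

    (II) says that Carlitz's logarithm inverts his exponential ([carlitz_log_exp]), with two terms
    moved to the other side. *)

Section PairSums.
Variable R : nmodType.

Fixpoint pairsum (T : Type) (g : T -> T -> R) (s : seq T) : R :=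
  if s is x :: s' then \sum_(y <- s') g x y + pairsum g s' else 0.

Lemma pairsum_nth (T : Type) (x0 : T) (g : T -> T -> R) s :
  pairsum g s = \sum_(i < size s) \sum_(j < size s | (i < j)%N)
                  g (nth x0 s i) (nth x0 s j).
Proof.
elim: s => [|x s IHs] /=; first by rewrite big_ord0.
rewrite big_ord_recl; congr (_ + _).
  by rewrite [RHS]big_mkcond big_ord_recl /= add0r (big_nth x0) big_mkord.
rewrite IHs; apply: eq_bigr => i _.
by rewrite [RHS]big_mkcond big_ord_recl /= add0r -big_mkcond.
Qed.

Lemma pairsum_map (T U : Type) (f : T -> U) (g : U -> U -> R) s :
  pairsum g (map f s) = pairsum (fun x y => g (f x) (f y)) s.
Proof. by elim: s => //= x s ->; rewrite big_map. Qed.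

Lemma pairsumD (T : Type) (g h : T -> T -> R) s :
  pairsum (fun x y => g x y + h x y) s = pairsum g s + pairsum h s.
Proof. by elim: s => /= [|x s ->]; rewrite ?addr0 // big_split /= addrACA. Qed.

Lemma pairsum_cat (T : Type) (g : T -> T -> R) s t :
  pairsum g (s ++ t) =
    pairsum g s + pairsum g t + \sum_(x <- s) \sum_(y <- t) g x y.
Proof.
elim: s => [|x s IHs] /=; first by rewrite big_nil addr0 add0r.
rewrite IHs big_cat big_cons /= -!addrA; congr (_ + _).
by rewrite addrCA; congr (_ + _); rewrite addrCA.
Qed.

Lemma pairsum_perm (T : eqType) (g : T -> T -> R) s t :
  (forall x y, g x y = g y x) -> perm_eq s t -> pairsum g s = pairsum g t.
Proof.
move=> gC; elim: s t => [|x s IHs] t eq_st.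
  by rewrite perm_sym in eq_st; rewrite (perm_nilP eq_st).
have /splitPr eq_t: x \in t by rewrite -(perm_mem eq_st) mem_head.
case: eq_t eq_st => t1 t2; rewrite perm_sym -cat1s perm_catCA /= perm_cons.
rewrite perm_sym => eq_st.
rewrite (IHs _ eq_st) (perm_big _ eq_st) /= !pairsum_cat /= big_cat /=.
have -> : \sum_(y <- t1) \sum_(z <- x :: t2) g y z =
    \sum_(y <- t1) g x y + \sum_(y <- t1) \sum_(z <- t2) g y z.
  by rewrite -big_split; apply: eq_bigr => y _; rewrite big_cons gC.
by rewrite !addrA [RHS](ACl (4*2*1*3*5)).
Qed.

Lemma eq_in_pairsum (T : eqType) (g h : T -> T -> R) s : uniq s ->
  {in s &, forall x y, x != y -> g x y = h x y} -> pairsum g s = pairsum h s.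
Proof.
elim: s => //= x s IHs /andP[xNs us] eq_gh; congr (_ + _).
  apply: eq_big_seq => y ys; apply: eq_gh; rewrite ?mem_head ?inE ?ys ?orbT //.
  by apply: contraNneq xNs => ->.
by apply: IHs => // y z ys zs; apply: eq_gh; rewrite inE ?ys ?zs orbT.
Qed.

Lemma pairsum_sym (T : eqType) (g : T -> T -> R) s : uniq s ->
  pairsum (fun x y => g x y + g y x) s =
    \sum_(x <- s) \sum_(y <- s | y != x) g x y.
Proof.
elim: s => [|x s IHs] /=; first by rewrite big_nil.
case/andP=> xNs us; rewrite big_split /= !big_cons eqxx /= IHs //.
rewrite -addrA; congr (_ + _).
  rewrite [RHS]big_seq_cond [LHS]big_seq; apply: eq_bigl => y.
  by case: (boolP (y \in s)) => //= ys; rewrite (contraNneq _ xNs) // => <-.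
rewrite -big_split; apply: eq_big_seq => y ys /=.
by rewrite big_cons (contraNneq _ xNs) // => ->.
Qed.

End PairSums.

Notation e2 := (pairsum *%R).

Section Char2.
Variable R : comNzRingType.
Hypothesis charR : 2 \in [pchar R].

Lemma subr_char2 (x y : R) : x - y = x + y.
Proof. by rewrite oppr_pchar2. Qed.

Lemma expr2nD k (x y : R) : (x + y) ^+ (2 ^ k) = x ^+ (2 ^ k) + y ^+ (2 ^ k).
Proof. by apply: exprDn_pchar; rewrite pnatX pnatE // charR. Qed.

Lemma expr2n_sum (I : Type) (s : seq I) (P : pred I) (F : I -> R) k :
  (\sum_(i <- s | P i) F i) ^+ (2 ^ k) = \sum_(i <- s | P i) F i ^+ (2 ^ k).
Proof.
apply: (big_morph (fun x : R => x ^+ (2 ^ k))) => [x y|]; first exact: expr2nD.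
by rewrite expr0n expn_eq0.
Qed.

Lemma pairsum_expr2n (T : Type) (g : T -> T -> R) s k :
  pairsum g s ^+ (2 ^ k) = pairsum (fun x y => g x y ^+ (2 ^ k)) s.
Proof.
elim: s => [|x s IHs] /=; first by rewrite expr0n expn_eq0.
by rewrite expr2nD IHs expr2n_sum.
Qed.

End Char2.

(** * Reciprocal power sums of the nonzero elements of a finite group *)

Section PowerSumsOfSubspaces.
Variable K : fieldType.
Hypothesis charK : 2 \in [pchar K].
Implicit Types (v w : K) (s : seq K).

Lemma addr_eq0_pchar2 v w : (v + w == 0) = (v == w).
Proof. by rewrite -[RHS]subr_eq0 oppr_pchar2. Qed.

Lemma divr_exp2n v k : v != 0 -> v / v ^+ (2 ^ k) = v ^- (2 ^ k - 1).
Proof.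
move=> v0; rewrite -{1}[(2 ^ k)%N](@subnK 1) ?expn_gt0 // addn1 exprS invfM.
by rewrite mulrA mulfV ?mul1r.
Qed.

Definition invpsum k s : K := \sum_(v <- s) v ^- (2 ^ k - 1).

(** The square root of e_2 of the v^-(2^(k+1) - 1); index k corresponds to X_(k+1). *)
Definition pairX k s : K :=
  \sum_(v <- s) \sum_(w <- s | w != v) v / (v * w) ^+ (2 ^ k).

(** The product of the two power sums runs over all ordered pairs; its diagonal is [invpsum k.+1 s],
    which the first term cancels. *)
Lemma pairXE k s : 0 \notin s -> uniq s ->
  pairX k s = invpsum k.+1 s + invpsum k s * invpsum 1 s ^+ (2 ^ k).
Proof.
move=> s0 us; rewrite /pairX /invpsum mulr_suml -big_split /=.
apply: eq_big_seq => v vs; rewrite expr2n_sum // mulr_sumr (bigD1_seq v) //=.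
have v0 : v != 0 by apply: contraNneq s0 => <-.
rewrite (subn1 (2 ^ 1)) /= expr1.
have -> : v ^- (2 ^ k - 1) * v^-1 ^+ (2 ^ k) = v ^- (2 ^ k.+1 - 1).
  by rewrite exprVn -invfM -exprD expnS mul2n -addnn addnBAC ?expn_gt0.
rewrite addrA addrr_pchar2 // add0r; apply: eq_bigr => w _.
by rewrite exprMn invfM mulrA divr_exp2n // exprVn.
Qed.

(* With u = v + w one has 1/(vw) = 1/(vu) + 1/(wu), and v^2 + vw + w^2 is     *)
(* symmetric in u, v, w: the sum over pairs {v, w} becomes a sum over ordered *)
(* pairs (v, u), each unordered pair being counted twice.                     *)
Lemma pairsum_triples0 k s : 0 \notin s -> uniq s ->
    {in s &, forall v w, v != w -> v + w \in s} ->
  pairsum (fun v w => (v ^+ 2 + v * w + w ^+ 2) / (v * w) ^+ (2 ^ k)) s = 0.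
Proof.
move=> s0 us sD; set sg := fun v w => _.
have nz v : v \in s -> v != 0 by move=> vs; apply: contraNneq s0 => <-.
have sgC v w : sg v w = sg w v.
  by rewrite /sg [w * v]mulrC; congr (_ / _); ring.
transitivity (pairsum (fun v w => sg v (v + w) + sg w (w + v)) s).
  apply: eq_in_pairsum => // v w vs ws vw.
  have v_nz := nz _ vs; have w_nz := nz _ ws; have u_nz := nz _ (sD _ _ vs ws vw).
  rewrite /sg [w + v]addrC; set u := v + w in u_nz *.
  have -> : v ^+ 2 + v * u + u ^+ 2 = v ^+ 2 + v * w + w ^+ 2.
    rewrite /u; transitivity (v ^+ 2 + v * w + w ^+ 2 + 2%:R * (v ^+ 2 + v * w)).
      by ring.
    by rewrite (pcharf0 charK) mul0r addr0.
  have -> : w ^+ 2 + w * u + u ^+ 2 = v ^+ 2 + v * w + w ^+ 2.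
    rewrite /u; transitivity (v ^+ 2 + v * w + w ^+ 2 + 2%:R * (w ^+ 2 + v * w)).
      by ring.
    by rewrite (pcharf0 charK) mul0r addr0.
  rewrite -[RHS]mulrDr -!exprVn -expr2nD //; congr (_ * _ ^+ _).
  by move: u_nz; rewrite /u => u_nz; field; rewrite v_nz w_nz u_nz.
rewrite pairsum_sym //.
transitivity (\sum_(v <- s) \sum_(w <- s | w != v) sg v w); last first.
  rewrite -pairsum_sym // (_ : pairsum _ s = pairsum (fun _ _ => 0) s).
    by elim: s {s0 us sD nz} => //= x s ->; rewrite big1 ?addr0.
  by apply: eq_in_pairsum => // v w _ _ _; rewrite sgC addrr_pchar2.
(* For fixed v, translation by v permutes the elements of s other than v. *)
apply: eq_big_seq => v vs.
rewrite -[LHS]big_filter -[RHS]big_filter -(big_map (+%R v) xpredT (sg v)).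
apply: perm_big; apply: uniq_perm; rewrite ?filter_uniq // ?map_inj_uniq.
- by rewrite filter_uniq.
- exact: addrI.
have shift w : w \in s -> w != v -> v + w \in [seq x <- s | x != v].
  move=> ws wv; rewrite mem_filter sD 1?[v == w]eq_sym // andbT.
  by rewrite -subr_eq0 addrAC subrr add0r nz.
move=> w; apply/mapP/idP => [[x] | ]; rewrite mem_filter => /andP[wv ws].
  by move->; apply: shift.
exists (v + w); first exact: shift.
by rewrite addrA addrr_pchar2 ?add0r.
Qed.

(** Squaring is additive, so [pairX k s ^+ 2] is the pair sum of (v^2 + w^2)/(vw)^(2^(k+1)), while
    e_2 is that of vw/(vw)^(2^(k+1)). Their total is the vanishing sum of [pairsum_triples0]. *)
Lemma e2_invpower k s : 0 \notin s -> uniq s ->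
    {in s &, forall v w, v != w -> v + w \in s} ->
  pairsum (fun v w => v ^- (2 ^ k.+1 - 1) * w ^- (2 ^ k.+1 - 1)) s =
    pairX k s ^+ 2.
Proof.
move=> s0 us sD.
have nz v : v \in s -> v != 0 by move=> vs; apply: contraNneq s0 => <-.
rewrite /pairX -pairsum_sym // (pairsum_expr2n charK _ _ 1).
apply/eqP; rewrite -addr_eq0_pchar2 -pairsumD; apply/eqP.
rewrite -[RHS](pairsum_triples0 k.+1 s0 us sD).
apply: eq_in_pairsum => // v w vs ws _; have v_nz := nz _ vs;
  have w_nz := nz _ ws.
rewrite -invfM -exprMn [w * v]mulrC -mulrDl.
rewrite [((v + w) / _) ^+ _]exprMn -[(v * w) ^- (2 ^ k)]exprVn -exprM.
rewrite -[(2 ^ k * 2 ^ 1)%N]expnD addn1.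
have vw_nz : v * w != 0 by rewrite mulf_neq0.
rewrite -divr_exp2n //.
rewrite -exprVn -mulrDl; congr (_ * _).
rewrite sqrrD mulr2n addrr_pchar2 // addr0.
by rewrite addrA [v * w + _]addrC.
Qed.

End PowerSumsOfSubspaces.

Section Coset.
Variable K : fieldType.
Hypothesis charK : 2 \in [pchar K].

(* W is the set of nonzero elements of a finite group and Y another coset of  *)
(* that group. In the expanded right-hand side the terms b != y cancel: those *)
(* with b in Y become, for w = y + b in W, the terms with b in W.             *)
Lemma invpsum_coset k (W Y : seq K) :
    0 \notin W -> 0 \notin Y -> uniq W -> uniq Y ->
    (forall w y, w \in W -> y \in Y -> w + y \in Y) ->
    {in Y &, forall y z, y != z -> y + z \in W} ->
  invpsum k.+1 Y = invpsum 1 Y ^+ (2 ^ k) * invpsum k (W ++ Y).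
Proof.
move=> W0 Y0 uW uY WY YY.
have nzW v : v \in W -> v != 0 by move=> vs; apply: contraNneq W0 => <-.
have nzY v : v \in Y -> v != 0 by move=> vs; apply: contraNneq Y0 => <-.
have -> : invpsum 1 Y = \sum_(y <- Y) y^-1.
  by apply: eq_bigr => y _; rewrite subn1 expr1.
pose N := (2 ^ k)%N.
have permY w : w \in W -> perm_eq (map (+%R w) Y) Y.
  move=> wW; apply: uniq_perm; rewrite ?map_inj_uniq //; first exact: addrI.
  move=> y; apply/mapP/idP => [[z zY ->]|yY]; first exact: WY.
  by exists (w + y); rewrite ?WY // addrA addrr_pchar2 // add0r.
have permW y : y \in Y -> perm_eq (map (+%R y) W) [seq z <- Y | z != y].
  move=> yY; apply: uniq_perm; rewrite ?map_inj_uniq ?filter_uniq //.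
    exact: addrI.
  move=> z; rewrite mem_filter.
  apply/mapP/andP => [[w wW ->]|[zy zY]].
    by rewrite -subr_eq0 addrAC subrr add0r nzW // addrC WY.
  by exists (y + z); rewrite ?YY 1?eq_sym // addrA addrr_pchar2 // add0r.
have S12 : \sum_(y <- Y) \sum_(z <- Y | z != y) z / (y * z) ^+ N =
           \sum_(y <- Y) \sum_(w <- W) w / (y * w) ^+ N.
  transitivity (\sum_(w <- W) \sum_(y <- Y) (y + w) / (y * (y + w)) ^+ N).
    rewrite exchange_big; apply: eq_big_seq => y yY /=.
    by rewrite -big_filter -(perm_big _ (permW y yY)) big_map.
  rewrite [RHS]exchange_big; apply: eq_big_seq => w wW /=.
  transitivity (\sum_(y <- Y) (y + w) / (w * y) ^+ N +
                \sum_(y <- Y) (w + y) / (w * (w + y)) ^+ N).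
    rewrite -big_split; apply: eq_big_seq => y yY /=.
    have w_nz := nzW w wW; have y_nz := nzY y yY.
    have wy_nz := nzY _ (WY w y wW yY).
    rewrite [w + y]addrC -mulrDr -!exprVn -expr2nD //; congr (_ * _ ^+ _).
    rewrite addrC in wy_nz.
    (* The term with 2 is zero; with it the identity holds in any field. *)
    transitivity (1 / (w * y) + 1 / (w * (y + w))  - 2%:R / (w * (y + w))).
      by field; rewrite y_nz w_nz wy_nz.
    by rewrite (pcharf0 charK) mul0r subr0 !mul1r.
  rewrite -(big_map (+%R w) xpredT (fun y => y / (w * y) ^+ N)).
  rewrite (perm_big _ (permY w wW)) -big_split; apply: eq_bigr => y _ /=.
  rewrite -mulrDl [y * w]mulrC addrAC addrr_pchar2 // add0r //.
rewrite expr2n_sum // /invpsum mulr_suml.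
transitivity (\sum_(y <- Y) y ^- (2 ^ k.+1 - 1) +
    (\sum_(y <- Y) \sum_(w <- W) w / (y * w) ^+ N +
     \sum_(y <- Y) \sum_(z <- Y | z != y) z / (y * z) ^+ N)).
  by rewrite S12 addrr_pchar2 // addr0.
rewrite -[X in _ + X]big_split -big_split; apply: eq_big_seq => y yY /=.
rewrite big_cat mulrDr /= addrCA; congr (_ + _).
  rewrite mulr_sumr; apply: eq_big_seq => w wW.
  by rewrite -divr_exp2n ?nzW // exprVn exprMn invfM mulrCA.
rewrite (bigD1_seq y) //= mulrDr; congr (_ + _).
  by rewrite exprVn -invfM -exprD addnBA ?expn_gt0 // addnn -mul2n -expnS.
rewrite mulr_sumr big_seq_cond [RHS]big_seq_cond; apply: eq_bigr => z /andP[zY _].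
by rewrite -divr_exp2n ?nzY // exprVn exprMn invfM mulrCA.
Qed.

End Coset.

(** * Newton's identities *)

Section TwistedInverse.
Variable R : comNzRingType.
Hypothesis charR : 2 \in [pchar R].
Implicit Types a b : nat -> R.

(** Coefficients of a product of power series in tau, where tau c = c^2 tau: composition of additive
    power series. *)
Definition twmul a b n := \sum_(k < n.+1) a k * b (n - k)%N ^+ (2 ^ k).

(** Truncated twisted series as upper triangular matrices, multiplicatively by [mul_twmx]. *)
Definition twmx N a : 'M[R]_N :=
  \matrix_(i, j) if (i <= j)%N then a (j - i)%N ^+ (2 ^ i) else 0.

Lemma mul_twmx N a b : twmx N a *m twmx N b = twmx N (twmul a b).
Proof.
apply/matrixP => i j; rewrite !mxE; case: leqP => [le_ij|lt_ji]; last first.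
  rewrite big1 // => k _; rewrite !mxE; case: leqP => [le_ik|_];
    last by rewrite mul0r.
  by rewrite leqNgt (leq_trans lt_ji le_ik) mulr0.
pose F k := a (k - i)%N ^+ (2 ^ i) * b (j - k)%N ^+ (2 ^ k).
transitivity (\sum_(i <= k < j.+1) F k).
  rewrite big_geq_mkord (big_ord_widen_cond N (fun k => i <= k)%N F) //.
  rewrite [RHS]big_mkcond; apply: eq_bigr => k _; rewrite !mxE ltnS /F.
  by do 2!case: ifP => _; rewrite ?mul0r ?mulr0.
rewrite -{1}[i : nat]add0n big_addn big_mkord subSn // expr2n_sum //.
apply: eq_bigr => k _; rewrite /F addnK exprMn -exprM addnC subnDA.
by rewrite expnD mulnC.
Qed.

(** A one-sided inverse of a square matrix is two-sided; the corner entry of the product is the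
    coefficient wanted. *)
Lemma twmul_inv a b : a 0%N = 1 -> b 0%N = 1 ->
    (forall n, twmul a b n.+1 = 0) -> forall n, twmul b a n.+1 = 0.
Proof.
move=> a0 b0 ab n.
have tw1 (c : nat -> R) : c 0%N = 1 -> (forall n, c n.+1 = 0) ->
  twmx n.+2 c = 1%:M.
  move=> c0 cS; apply/matrixP => i j; rewrite !mxE -val_eqE /=.
  case: (ltngtP i j) => [lt_ij|//|->]; last by rewrite subnn c0 expr1n.
  by rewrite -[(j - i)%N]prednK ?subn_gt0 // cS expr0n expn_eq0.
have := mul_twmx n.+2 a b; rewrite [RHS]tw1 //; last first.
  by rewrite /twmul big_ord1 a0 b0 mul1r.
move/mulmx1C; rewrite mul_twmx => /matrixP/(_ ord0 ord_max).
by rewrite !mxE /= subn0 expn0 expr1.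
Qed.

(** Without its term k = n, the recursion for f_(n+1) is the formula for X_(n+1). Hence f obeys the
    recursion of [fpoly eps] and coincides with it. *)
Lemma XpolySE (eps f : nat -> R) : f 0%N = 1 ->
  (forall n, f n.+1 = - \sum_(k < n.+1) f k * eps (n.+1 - k)%N ^+ (2 ^ k)) ->
  forall n, Xpoly eps n.+1 = f n.+1 + f n * eps 1%N ^+ (2 ^ n).
Proof.
move=> f0 fS.
have Xf n : (forall k, (k <= n)%N -> fpoly eps k = f k) ->
    Xpoly eps n.+1 = f n.+1 + f n * eps 1%N ^+ (2 ^ n).
  move=> eq_f; rewrite XpolyE // /Xformula fS big_ord_recr /= subSnn.
  rewrite opprD addrNK oppr_pchar2 //; apply: eq_bigr => k _.
  by rewrite eq_f 1?mulrC // ltnW.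
have ff n : forall k, (k <= n)%N -> fpoly eps k = f k.
  elim: n => [|n IHn] k; first by rewrite leqn0 => /eqP->.
  rewrite leq_eqVlt ltnS => /predU1P[->|/IHn //].
  by rewrite fpolyS Xf // IHn // addrCA addrr_pchar2 // addr0.
by move=> n; apply: Xf => k _; apply: (ff k).
Qed.

Definition mpsum (xs : seq R) n := \sum_(x <- xs) x ^+ (2 ^ n - 1).

(** The logarithmic derivative of the product is the sum of the x/(1 + xX), expanded as geometric
    series without signs in characteristic 2; [T] absorbs the tails. *)
Lemma log_deriv_trunc (xs : seq R) M :
  exists T : {poly R},
    \prod_(x <- xs) (1 + x *: 'X) * \sum_(x <- xs) \poly_(j < M) x ^+ j.+1 =
    (\prod_(x <- xs) (1 + x *: 'X))^`() + 'X^M * T.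
Proof.
elim: xs => [|x xs [T IHxs]].
  by exists 0; rewrite !big_nil mulr0 derivC mulr0 addr0.
set E := \prod_(x <- xs) _ in IHxs; set S := \sum_(x <- xs) _ in IHxs.
have Sx : (1 + x *: 'X) * \poly_(j < M) x ^+ j.+1 = x%:P + x ^+ M.+1 *: 'X^M.
  rewrite poly_def.
  have -> : \sum_(j < M) x ^+ j.+1 *: 'X^j = x *: \sum_(j < M) (x *: 'X) ^+ j.
    by rewrite scaler_sumr; apply: eq_bigr => j _; rewrite exprZn scalerA exprS.
  have charP : 2 \in [pchar {poly R}] by rewrite pchar_poly.
  rewrite -scalerAr addrC -(subr_char2 charP) -subrX1 (subr_char2 charP).
  by rewrite scalerDr exprZn scalerA -exprS addrC alg_polyC.
have comb (A : comNzRingType) (u c d e e' s p xm t : A) :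
    u * p = c + d * xm -> e * s = e' + xm * t ->
    u * e * (p + s) = c * e + u * e' + xm * (u * t + d * e).
  move=> up es; transitivity (e * (u * p) + u * (e * s)); first by ring.
  by rewrite up es; ring.
exists ((1 + x *: 'X) * T + (x ^+ M.+1)%:P * E).
rewrite !big_cons -/E -/S derivM.
have -> : (1 + x *: 'X)^`() = x%:P.
  by rewrite derivD derivC derivZ derivX add0r alg_polyC.
by apply: comb => //; rewrite Sx -mul_polyC.
Qed.

(** Compare coefficients of X^(2^(n+1) - 2) in [log_deriv_trunc]. The derivative contributes the odd
    multiple 2^(n+1) - 1 of [eps n.+1]; in the product [eps k] meets the power sum of exponent
    2^(n+1) - 2^k = 2^k (2^(n+1-k) - 1), a Frobenius power of a [mpsum]. *)
Lemma newton_mersenne (xs : seq R) (eps : nat -> R) (b : nat) : eps 0%N = 1 ->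
    (forall k, (b <= k)%N -> eps k = 0) ->
    \prod_(x <- xs) (1 + x *: 'X) = \sum_(k < b) eps k *: 'X^(2 ^ k - 1) ->
  forall n, eps n.+1 + \sum_(k < n.+1) eps k * mpsum xs (n.+1 - k) ^+ (2 ^ k) = 0.
Proof.
move=> eps0 epsb defE n; have [T] := log_deriv_trunc xs (2 ^ n.+1).
rewrite defE => /(congr1 (fun p : {poly R} => p`_(2 ^ n.+1 - 2))).
have gt1 : (1 < 2 ^ n.+1)%N by rewrite -{1}(expn0 2) ltn_exp2l.
have lt2 : (2 ^ n.+1 - 2 < 2 ^ n.+1)%N by rewrite ltn_subrL (ltnW gt1).
rewrite coefD coefXnM lt2 addr0 coef_deriv -subSn // subSS.
have pX k m : ('X^(2 ^ k - 1) : {poly R})`_(2 ^ m - 1) = (m == k)%:R.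
  rewrite coefXn; congr (nat_of_bool _)%:R.
  by rewrite -(eqn_add2r 1) !subnK ?expn_gt0 // eqn_exp2l.
have epsE : (\sum_(k < b) eps k *: 'X^(2 ^ k - 1))`_(2 ^ n.+1 - 1) = eps n.+1.
  rewrite coef_sum; have [lt_nb|le_bn] := ltnP n.+1 b.
    rewrite (bigD1 (Ordinal lt_nb)) //= coefZ pX eqxx mulr1 big1 ?addr0 //.
    move=> k; rewrite -val_eqE /= coefZ pX eq_sym => /negPf->.
    by rewrite mulr0.
  rewrite epsb // big1 // => k _; rewrite coefZ pX gtn_eqF ?mulr0 //.
  exact: leq_trans (ltn_ord k) le_bn.
rewrite epsE -mulr_natr.
have -> : (2 ^ n.+1 - 1)%:R = 1 :> R.
  rewrite natrB ?expn_gt0 // natrX (pcharf0 charR) expr0n sub0r.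
  by rewrite oppr_pchar2.
rewrite mulr1 => <-.
rewrite mulr_suml coef_sum.
pose F k := eps k * mpsum xs (n.+1 - k) ^+ (2 ^ k).
have Fk (k : 'I_b) : (eps k *: 'X^(2 ^ k - 1) *
     \sum_(x <- xs) \poly_(j < 2 ^ n.+1) x ^+ j.+1)`_(2 ^ n.+1 - 2) =
     if (k < n.+1)%N then F k else 0.
  rewrite -scalerAl coefZ coefXnM.
  have [lt_kn|le_nk] := ltnP k n.+1; last first.
    have le2 : (2 ^ n.+1 <= 2 ^ k)%N by rewrite leq_exp2l.
    rewrite ifT ?mulr0 //; move: gt1 le2.
    by move: (2 ^ k)%N (2 ^ n.+1)%N => p q; lia.
  have lt2k : (2 ^ k < 2 ^ n.+1)%N by rewrite ltn_exp2l.
  rewrite ifF; last first.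
    by move: lt2k gt1; move: (2 ^ k)%N (2 ^ n.+1)%N => p q; lia.
  rewrite coef_sum /F /mpsum expr2n_sum //; congr (_ * _).
  apply: eq_bigr => x _; rewrite coef_poly ifT; last first.
    by rewrite (leq_ltn_trans (leq_subr _ _)).
  rewrite -exprM mulnBl mul1n -expnD subnK ?(ltnW lt_kn) //; congr (_ ^+ _).
  move: lt2k gt1; have := expn_gt0 2 k.
  by move: (2 ^ k)%N (2 ^ n.+1)%N => p q; lia.
rewrite (eq_bigr _ (fun k _ => Fk k)) -big_mkcond /=.
(* The two sums differ only in k >= b, where [eps] vanishes. *)
rewrite (big_ord_widen_cond (b + n.+1) (fun k => k < n.+1)%N F) ?leq_addr //.
rewrite (big_ord_widen (b + n.+1) F) ?leq_addl // big_mkcondr.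
rewrite [X in X + _](_ : _ = \sum_(k < b + n.+1 | (k < n.+1)%N) F k).
  by rewrite addrr_pchar2.
apply: eq_bigr => k _; case: ltnP => // le_bk.
by rewrite /F epsb // mul0r.
Qed.

End TwistedInverse.

(** * Part (II) *)

Lemma pchar_F2x : 2 \in [pchar {poly 'F_2}].
Proof. by rewrite pchar_poly pchar_Fp. Qed.

Lemma brk_neq0 i : (0 < i)%N -> brk i != 0.
Proof.
move=> i0; apply/eqP => /(congr1 (fun p : {poly 'F_2} => p`_(2 ^ i))).
rewrite coefB coefXn coefX eqxx coef0 gtn_eqF ?subr0.
  by move/eqP; rewrite oner_eq0.
by rewrite (ltn_exp2l 0 i (ltnSn 1)).
Qed.

Lemma brk_exp2n n k : (k <= n)%N -> brk (n - k) ^+ (2 ^ k) = brk n + brk k.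
Proof.
move=> le_kn; rewrite /brk !(subr_char2 pchar_F2x) (expr2nD pchar_F2x).
by rewrite -exprM -expnD subnK // addrACA (addrr_pchar2 pchar_F2x) addr0.
Qed.

Lemma DpolyS i : Dpoly i.+1 = brk i.+1 * Dpoly i ^+ 2.
Proof.
rewrite /Dpoly big_ord_recl expn0 expr1; congr (_ * _).
rewrite -prodrXl; apply: eq_bigr => j _; rewrite /= /bump add1n.
rewrite !(subr_char2 pchar_F2x) (expr2nD pchar_F2x 1).
by rewrite -!exprM -!expnSr.
Qed.

Lemma LpolyS i : Lpoly i.+1 = Lpoly i * brk i.+1.
Proof. by rewrite /Lpoly big_nat_recr. Qed.

Lemma Dpoly_neq0 i : Dpoly i != 0.
Proof.
elim: i => [|i IHi]; first by rewrite /Dpoly big_ord0 oner_eq0.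
by rewrite DpolyS mulf_neq0 ?brk_neq0 ?expf_neq0.
Qed.

Lemma Lpoly_neq0 i : Lpoly i != 0.
Proof.
elim: i => [|i IHi]; first by rewrite /Lpoly big_geq ?oner_eq0.
by rewrite LpolyS mulf_neq0 ?brk_neq0.
Qed.

Lemma pchar_F2t : 2 \in [pchar F2t].
Proof. exact: (rmorph_pchar (@tofrac _) pchar_F2x). Qed.

(** The coefficient of z^(2^(n+1)) in Carlitz's logarithm composed with his exponential. *)
Lemma carlitz_log_exp n :
  \sum_(k < n.+2) (Dfrac (n.+1 - k) ^+ (2 ^ k) * Lfrac k)^-1 = 0.
Proof.
pose b i : F2t := tofrac (brk i).
have b_nz i : (0 < i)%N -> b i != 0 by move=> i0; rewrite tofrac_eq0 brk_neq0.
have b0 : b 0%N = 0 by rewrite /b /brk expr1 subrr rmorph0.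
have D_nz i : Dfrac i != 0 by rewrite tofrac_eq0 Dpoly_neq0.
have L_nz i : Lfrac i != 0 by rewrite tofrac_eq0 Lpoly_neq0.
have DS i : Dfrac i.+1 = b i.+1 * Dfrac i ^+ 2.
  by rewrite /Dfrac DpolyS rmorphM rmorphXn.
have LS i : Lfrac i.+1 = Lfrac i * b i.+1 by rewrite /Lfrac LpolyS rmorphM.
have bX m k : (k <= m)%N -> b m = b (m - k)%N ^+ (2 ^ k) + b k.
  move=> le_km; rewrite /b; have {1}-> : brk m = brk (m - k) ^+ (2 ^ k) + brk k.
    by rewrite brk_exp2n // -addrA (addrr_pchar2 pchar_F2x) addr0.
  by rewrite rmorphD rmorphXn.
apply: (mulfI (b_nz n.+1 isT)); rewrite mulr0 mulr_sumr.
(* Write [n+1] = [n+1-k]^(2^k) + [k] in each term. The first summand cancels a factor of D, the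
   second one of L; after an index shift both halves are the sum of [G]. *)
pose G k : F2t := (Dfrac (n - k) ^+ (2 ^ k.+1) * Lfrac k)^-1.
transitivity (\sum_(k < n.+1) G k + \sum_(k < n.+1) G k); last first.
  by rewrite addrr_pchar2 // pchar_F2t.
transitivity (\sum_(k < n.+2)
    (b (n.+1 - k)%N ^+ (2 ^ k) * (Dfrac (n.+1 - k) ^+ (2 ^ k) * Lfrac k)^-1 +
     b k * (Dfrac (n.+1 - k) ^+ (2 ^ k) * Lfrac k)^-1)).
  by apply: eq_bigr => k _; rewrite -mulrDl -bX // -ltnS.
rewrite big_split; congr (_ + _).
  rewrite big_ord_recr /= subnn b0 expr0n expn_eq0 mul0r addr0.
  apply: eq_bigr => k _ /=; rewrite /G subSn -1?ltnS // DS exprMn -exprM -expnS.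
  by rewrite -mulrA invfM mulrA mulfV ?mul1r // expf_neq0 ?b_nz.
rewrite big_ord_recl /= b0 mul0r add0r; apply: eq_bigr => k _ /=.
rewrite /bump /= add1n subSS LS /G mulrA invfM mulrCA mulfV ?b_nz ?mulr1 //.
Qed.

Fact carlitz_A_algebra (K : fieldType) (x y z : K) :
  x != 0 -> y != 0 -> z != 0 ->
  (x * y)^-1 + (y * z)^-1 = (z + x) / (y * z * x).
Proof. by move=> x0 y0 z0; field; rewrite x0 y0 z0. Qed.

(** The sum equals the two last terms, k = n - 1 and k = n, of the vanishing full sum; [n-1] = [n] +
    [1]^(2^(n-1)) combines them. *)
Lemma carlitz_A n : (0 < n)%N ->
  \sum_(k < n.-1) (Dfrac (n - k) ^+ (2 ^ k) * Lfrac k)^-1 = A_ n.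
Proof.
case: n => // n _ /=; have := carlitz_log_exp n.
rewrite !big_ord_recr /= subnn subSnn -addrA => /eqP.
rewrite addr_eq0_pchar2 ?pchar_F2t // => /eqP->; rewrite /A_ /=.
have nzL : Lfrac n != 0 by rewrite tofrac_eq0 Lpoly_neq0.
have nz1 : tofrac (brk 1) != 0 :> F2t by rewrite tofrac_eq0 brk_neq0.
have nzn : tofrac (brk n.+1) != 0 :> F2t by rewrite tofrac_eq0 brk_neq0.
have -> : Dfrac 0 = 1 by rewrite /Dfrac /Dpoly big_ord0 rmorph1.
have -> : Dfrac 1 = tofrac (brk 1) by rewrite /Dfrac /Dpoly big_ord1 expr1.
have -> : Lfrac n.+1 = Lfrac n * tofrac (brk n.+1)
  by rewrite /Lfrac LpolyS rmorphM.
have -> : tofrac (brk n) = tofrac (brk n.+1) + tofrac (brk 1) ^+ (2 ^ n) :> F2t.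
  have {1}-> : brk n = brk n.+1 + brk 1 ^+ (2 ^ n).
    have := brk_exp2n (leqnSn n); rewrite subSnn => ->.
    by rewrite addrA (addrr_pchar2 pchar_F2x) add0r.
  by rewrite rmorphD rmorphXn.
rewrite expr1n mul1r.
exact: (carlitz_A_algebra (expf_neq0 (2 ^ n) nz1) nzL nzn).
Qed.

(** * Valuations *)

(* The sets [v M] play the role of the M-th power of the maximal ideal.       *)
Structure filtration (K : fieldType) := Filtration {
  vge :> nat -> K -> Prop;
  vge0 : forall M, vge M 0;
  vge1 : vge 0%N 1;
  vgeD : forall M x y, vge M x -> vge M y -> vge M (x + y);
  vgeN : forall M x, vge M x -> vge M (- x);
  vgeM : forall M N x y, vge M x -> vge N y -> vge (M + N)%N (x * y);
  vgeW : forall M N x, (M <= N)%N -> vge N x -> vge M x;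
  vge_inv1D : forall x, vge 1%N x -> 1 + x != 0 /\ vge 0%N (1 + x)^-1
}.

Section FiltrationTheory.
Variables (K : fieldType) (v : filtration K).
Implicit Types x y : K.

Lemma vgeB M x y : v M x -> v M y -> v M (x - y).
Proof. by move=> vx vy; apply: vgeD => //; apply: vgeN. Qed.

Lemma vge_sum (I : eqType) M (s : seq I) (F : I -> K) :
  (forall i, i \in s -> v M (F i)) -> v M (\sum_(i <- s) F i).
Proof.
by move=> vF; rewrite big_seq; elim/big_ind: _ => //; [exact: vge0 | exact: vgeD].
Qed.

Lemma vgeX M k x : v M x -> v (M * k)%N (x ^+ k).
Proof.
move=> vx; elim: k => [|k IHk]; first by rewrite muln0; exact: vge1.
by rewrite exprS mulnS; apply: vgeM.
Qed.

Lemma vge0M x y : v 0%N x -> v 0%N y -> v 0%N (x * y).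
Proof. by move=> vx vy; rewrite -[0%N]addn0; apply: vgeM. Qed.

Lemma vge0Ml M x y : v 0%N x -> v M y -> v M (x * y).
Proof. by move=> vx vy; rewrite -[M]add0n; apply: vgeM. Qed.

Lemma vge0Mr M x y : v M x -> v 0%N y -> v M (x * y).
Proof. by move=> vx vy; rewrite -[M]addn0; apply: vgeM. Qed.

Lemma vge0X k x : v 0%N x -> v 0%N (x ^+ k).
Proof. by move=> vx; rewrite -[0%N](mul0n k); apply: vgeX. Qed.

End FiltrationTheory.

(** * Inversion of power series with constant term 1 *)

Section PowerSeriesInverse.
Variable R : comNzRingType.
Implicit Types a b : fps R.

Lemma fcoefM a b n :
  fcoef (a * b) n = \sum_(i < n.+1) fcoef a i * fcoef b (n - i)%N.
Proof. by []. Qed.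

Lemma fcoefD a b n : fcoef (a + b) n = fcoef a n + fcoef b n.
Proof. by []. Qed.

Lemma fcoefN a n : fcoef (- a) n = - fcoef a n.
Proof. by []. Qed.

Lemma fcoef_expr_eq0 a k n : fcoef a 0 = 0 -> (n < k)%N -> fcoef (a ^+ k) n = 0.
Proof.
move=> a0; elim: k n => // k IHk n; rewrite ltnS => le_nk.
rewrite exprS fcoefM big_ord_recl a0 mul0r add0r big1 // => i _.
rewrite IHk ?mulr0 //= /bump /= add1n.
by case: n {le_nk} i (le_nk) => [[] //|n] i le_nk;
  rewrite subSS (leq_ltn_trans _ le_nk) ?leq_subr.
Qed.

(** Geometric series in w = 1 - a. As w^k has no coefficient below k, the n-th coefficient is
    constant from the partial sum [S n] on. *)
Lemma fps_inv_exists a : fcoef a 0 = 1 -> exists b, b * a = 1.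
Proof.
move=> a0; pose w := 1 - a.
have w0 : fcoef w 0 = 0 by rewrite fcoefD fcoefN a0 subrr.
pose S n := \sum_(k < n.+1) w ^+ k.
have SE i n : (i <= n)%N -> fcoef (S n) i = fcoef (S i) i.
  move=> le_in; rewrite -(subnKC le_in); elim: (n - i)%N => [|j IHj].
    by rewrite addn0.
  rewrite addnS /S big_ord_recr fcoefD /= -/(S _) IHj fcoef_expr_eq0 ?addr0 //.
  by rewrite ltnS leq_addr.
exists (Fps (fun n => fcoef (S n) n)); apply: fpsP => n.
transitivity (fcoef (S n * a) n).
  by rewrite !fcoefM; apply: eq_bigr => i _; rewrite /= SE // -ltnS.
have -> : S n * a = 1 - w ^+ n.+1.
  rewrite -[a in LHS](subKr 1) -/w mulrC -opprB -[RHS]opprB subrX1 mulNr //.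
by rewrite fcoefD fcoefN fcoef_expr_eq0 ?subr0.
Qed.

End PowerSeriesInverse.

(** * The valuation of F_2((1/t)) *)

Section LaurentValuation.
Implicit Types x y z : F2Laurent.

Lemma pchar_F2L : 2 \in [pchar F2Laurent].
Proof. exact: (rmorph_pchar constL (pchar_Fp (isT : prime 2))). Qed.

Lemma u_inf_neq0 : u_inf != 0.
Proof.
rewrite tofrac_eq0; apply/eqP => /(congr1 (fun a => fcoef a 1)) /= /eqP.
by rewrite oner_eq0.
Qed.

Definition lvge M x := exists g : fps 'F_2, x = u_inf ^+ M * tofrac g.

Lemma lvge_tofrac g : lvge 0 (tofrac g).
Proof. by exists g; rewrite mul1r. Qed.

Lemma lvge0 M : lvge M 0.
Proof. by exists 0; rewrite rmorph0 mulr0. Qed.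

Lemma lvge1 : lvge 0 1.
Proof. by rewrite -(rmorph1 (@tofrac (fps 'F_2))); apply: lvge_tofrac. Qed.

Lemma lvgeD M x y : lvge M x -> lvge M y -> lvge M (x + y).
Proof. by move=> [g ->] [h ->]; exists (g + h); rewrite rmorphD mulrDr. Qed.

Lemma lvgeN M x : lvge M x -> lvge M (- x).
Proof. by move=> [g ->]; exists (- g); rewrite rmorphN mulrN. Qed.

Lemma lvgeM M N x y : lvge M x -> lvge N y -> lvge (M + N) (x * y).
Proof.
by move=> [g ->] [h ->]; exists (g * h); rewrite rmorphM mulrACA exprD.
Qed.

Lemma lvgeW M N x : (M <= N)%N -> lvge N x -> lvge M x.
Proof.
move=> le_MN [g ->]; exists (fpsX 'F_2 ^+ (N - M) * g).
by rewrite rmorphM rmorphXn mulrA -exprD subnKC.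
Qed.

Lemma lvge_inv1D x : lvge 1 x -> 1 + x != 0 /\ lvge 0 (1 + x)^-1.
Proof.
case=> g ->; have [|b ba1] := @fps_inv_exists _ (1 + fpsX 'F_2 * g).
  by rewrite fcoefD fcoefM big_ord1 /= mul0r addr0.
have e : tofrac b * (1 + u_inf ^+ 1 * tofrac g) = 1 :> F2Laurent.
  transitivity (tofrac (b * (1 + fpsX 'F_2 * g))); last by rewrite ba1 rmorph1.
  by rewrite rmorphM rmorphD rmorph1 rmorphM.
have nz : 1 + u_inf ^+ 1 * tofrac g != 0.
  by apply: contra_eq_neq e => ->; rewrite mulr0 eq_sym oner_eq0.
split=> //; have -> : (1 + u_inf ^+ 1 * tofrac g)^-1 = tofrac b.
  by apply: (mulIf nz); rewrite e mulVf.
exact: lvge_tofrac.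
Qed.

Definition laurent_filtration : filtration F2Laurent :=
  Filtration lvge0 lvge1 lvgeD lvgeN lvgeM lvgeW lvge_inv1D.

Lemma toL_is_zmod_morphism : zmod_morphism toL.
Proof. by move=> p q; rewrite /toL rmorphB hornerD hornerN. Qed.
HB.instance Definition _ :=
  GRing.isZmodMorphism.Build {poly 'F_2} F2Laurent toL toL_is_zmod_morphism.

Lemma toL_is_monoid_morphism : monoid_morphism toL.
Proof.
by split=> [|p q]; rewrite /toL ?rmorph1 ?hornerC // rmorphM hornerM.
Qed.
HB.instance Definition _ :=
  GRing.isMonoidMorphism.Build {poly 'F_2} F2Laurent toL toL_is_monoid_morphism.

Lemma F2_neq0 (c : 'F_2) : c != 0 -> c = 1.
Proof. by case: c => -[|[|[]]] // lt_c; rewrite // => _; apply: val_inj. Qed.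

(** The leading coefficient can only be 1, so p / t^(deg p) is an invertible power series in u =
    1/t. *)
Lemma toL_expand (p : {poly 'F_2}) : p != 0 ->
  exists2 a : fps 'F_2, fcoef a 0 = 1 & toL p * u_inf ^+ (size p).-1 = tofrac a.
Proof.
elim/poly_ind: p => [|p c IHp]; first by rewrite eqxx.
have toLc : toL c%:P = constL c by rewrite /toL map_polyC hornerC.
have toLX : toL 'X = u_inf^-1 by rewrite /toL map_polyX hornerX.
have [->|p0] := eqVneq p 0.
  rewrite mul0r add0r polyC_eq0 => /F2_neq0->; exists 1 => //.
  by rewrite rmorph1 size_poly1 mul1r rmorph1.
move=> _; have [a a0 pa] := IHp p0.
exists (a + fpsC c * fpsX 'F_2 ^+ size p).
  rewrite fcoefD a0 fcoefM big_ord1 fcoef_expr_eq0 ?mulr0 ?addr0 //.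
  by rewrite lt0n size_poly_eq0.
rewrite size_MXaddC (negPf p0) /= !rmorphD !rmorphM rmorphXn /= toLc toLX mulrDl.
congr (_ + _); rewrite -pa -mulrA; congr (_ * _).
rewrite -[size p in LHS]prednK ?lt0n ?size_poly_eq0 // exprS mulrA.
by rewrite mulVf ?u_inf_neq0 ?mul1r.
Qed.

Lemma toL_neq0_inv (p : {poly 'F_2}) : p != 0 ->
  toL p != 0 /\ lvge (size p).-1 (toL p)^-1.
Proof.
move=> p0; have [a a0 pa] := toL_expand p0.
have [b ba1] := fps_inv_exists a0.
have e : u_inf ^+ (size p).-1 * tofrac b * toL p = 1.
  by rewrite mulrC mulrA pa -rmorphM mulrC ba1 rmorph1.
have nz : toL p != 0 by apply: contra_eq_neq e => ->;
  rewrite mulr0 eq_sym oner_eq0.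
by split=> //; exists b; apply: (mulIf nz); rewrite e mulVf.
Qed.

Lemma toL_neq0 (p : {poly 'F_2}) : p != 0 -> toL p != 0.
Proof. by case/toL_neq0_inv. Qed.

Lemma lvge_toLV (p : {poly 'F_2}) : p != 0 -> lvge (size p).-1 (toL p)^-1.
Proof. by case/toL_neq0_inv. Qed.

End LaurentValuation.

(** * e_2 of product sets and of geometric progressions *)

Section E2Products.
Variable R : comNzRingType.
Implicit Types (s t : seq R) (x : R).

Lemma e2_scale x s : e2 (map ( *%R x) s) = x ^+ 2 * e2 s.
Proof.
rewrite pairsum_map; elim: s => [|y s IHs] /=; first by rewrite mulr0.
rewrite IHs mulrDr mulr_sumr; congr (_ + _).
by apply: eq_bigr => z _; rewrite mulrACA expr2.
Qed.

(** In characteristic 2 the sum of the x^2 is p_1(s)^2, so this makes e_2 / p_1^2 additive. *)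
Lemma e2_allpairs s t :
  e2 [seq x * y | x <- s, y <- t] =
    e2 s * (\sum_(y <- t) y) ^+ 2 + (\sum_(x <- s) x ^+ 2) * e2 t.
Proof.
elim: s => [|x s IHs]; first by rewrite big_nil /= mul0r mul0r addr0.
rewrite allpairs_cons pairsum_cat e2_scale IHs /= big_cons.
rewrite -big_distrlr big_map -mulr_sumr big_allpairs_dep -big_distrlr /=.
by rewrite -mulr_sumr; ring.
Qed.

(** Split off the entry 1: the other entries are x times the shorter progression. *)
Lemma e2_geometric x n :
  e2 [seq x ^+ j | j <- iota 0 n.+2] =
    x * \sum_(j < n.+1) x ^+ j + x ^+ 2 * e2 [seq x ^+ j | j <- iota 0 n.+1].
Proof.
have -> : [seq x ^+ j | j <- iota 0 n.+2] =
    1 :: map ( *%R x) [seq x ^+ j | j <- iota 0 n.+1].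
  have -> : iota 0 n.+2 = 0%N :: map (addn 1) (iota 0 n.+1) by rewrite -iotaDl.
  rewrite map_cons expr0; congr (_ :: _).
  by rewrite -!map_comp; apply: eq_map => j; rewrite /= add1n exprS.
rewrite -e2_scale; set s := [seq x ^+ j | j <- iota 0 n.+1].
rewrite (_ : e2 _ = \sum_(y <- map ( *%R x) s) 1 * y + e2 (map ( *%R x) s)) //.
rewrite !big_map mulr_sumr; congr (_ + _).
rewrite -[iota 0 _]/(index_iota 0 n.+1) big_mkord.
by apply: eq_bigr => j _; rewrite mul1r.
Qed.

End E2Products.

Section GeometricAlgebra.
Variables (K : fieldType) (x : K).
Hypothesis x1 : 1 - x != 0.

(** The limit of e_2 is the fixed point of the recursion [e2_geometric]. *)
Fact e2_geometric_limit : 2 \in [pchar K] ->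
  x / (1 - x) ^+ 3 = x / (1 - x) + x ^+ 2 * (x / (1 - x) ^+ 3).
Proof.
move=> charK; have e : (1 - x) ^+ 2 = 1 - x ^+ 2.
  by rewrite !(subr_char2 charK) (expr2nD charK 1) expr1n.
have nz2 : 1 - x ^+ 2 != 0 by rewrite -e expf_neq0.
by rewrite exprS e; field; rewrite x1 nz2.
Qed.

Fact e2_geometric_error e c :
  e - x / (1 - x) * c ^+ 2 =
    (e - x / (1 - x) ^+ 3) - x / (1 - x) * (c + (1 - x)^-1) * (c - (1 - x)^-1).
Proof. by field. Qed.

End GeometricAlgebra.

Section Filtration.
Variables (K : fieldType) (v : filtration K).
Hypothesis charK : 2 \in [pchar K].
Implicit Types x y z : K.

Lemma e2_cat_small M (s t : seq K) :
  (forall x, x \in s -> v 0%N x) -> (forall x, x \in t -> v M x) ->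
  v M (\sum_(x <- s ++ t) x - \sum_(x <- s) x) /\ v M (e2 (s ++ t) - e2 s).
Proof.
move=> vs vt.
have v_sum : v M (\sum_(x <- t) x) by apply: vge_sum.
split; first by rewrite big_cat /= addrAC subrr add0r.
have v_e2 : v M (e2 t).
  elim: t vt {v_sum} => [|x t IHt] vt /=; first exact: vge0.
  apply: vgeD; last by apply: IHt => y yt; apply: vt; rewrite inE yt orbT.
  apply: vge_sum => y yt; rewrite -[M]addn0; apply: vgeM.
    by apply: vt; rewrite mem_head.
  by apply: (vgeW (leq0n M)) => //; apply: vt; rewrite inE yt orbT.
rewrite pairsum_cat addrAC [e2 s + _ - _]addrAC subrr add0r; apply: vgeD => //.
rewrite -big_distrlr /= -[M]add0n; apply: vgeM => //.
exact: vge_sum.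
Qed.

(** For x = P^-m the ratio e_2 / p_1^2 is thus close to x/(1 - x) = 1/(P^m - 1). *)
Lemma geometric_mod x n : v 1%N x ->
  let c := \sum_(j < n) x ^+ j in
  v n (c - (1 - x)^-1) /\
  v n (e2 [seq x ^+ j | j <- iota 0 n] - x / (1 - x) * c ^+ 2).
Proof.
move=> vx c; have [nz vinv] := vge_inv1D (vgeN vx).
have vxn k : v k (x ^+ k) by have := vgeX k vx; rewrite mul1n.
have vx0 : v 0%N x := vgeW (leq0n 1) vx.
have cE k : \sum_(j < k) x ^+ j - (1 - x)^-1 = - (x ^+ k / (1 - x)).
  have -> : \sum_(j < k) x ^+ j = (1 - x ^+ k) / (1 - x).
    apply: (mulIf nz); rewrite mulfVK // -[RHS]opprB subrX1.
    by rewrite -mulNr opprB mulrC.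
  by field.
have vc k : v k (\sum_(j < k) x ^+ j - (1 - x)^-1).
  by rewrite cE; apply: vgeN; apply: vge0Mr.
split; first exact: vc.
(* Subtracting the two recursions multiplies earlier errors by x or x^2, so each step gains
   precision. *)
have vE k : v k (e2 [seq x ^+ j | j <- iota 0 k] - x / (1 - x) ^+ 3).
  have vinv3 : v 0%N ((1 - x) ^- 3) by rewrite -exprVn; apply: vge0X.
  case: k => [|k]; first by rewrite /= sub0r; apply: vgeN; apply: vge0M.
  elim: k => [|k IHk].
    by rewrite /= big_nil addr0 sub0r; apply: vgeN; apply: vge0Mr.
  rewrite e2_geometric.
  rewrite (e2_geometric_limit nz charK).
  set C := \sum_(j < _) _; set E := e2 _ in IHk *.
  have -> : x * C + x ^+ 2 * E - (x / (1 - x) + x ^+ 2 * (x / (1 - x) ^+ 3)) =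
     x * (C - (1 - x)^-1) + x ^+ 2 * (E - x / (1 - x) ^+ 3).
    by rewrite !mulrBr opprD addrACA.
  apply: vgeD; first by rewrite -add1n; apply: vgeM.
  by apply: (@vgeW _ v _ (2 + k.+1)); rewrite ?leqnSn //; apply: vgeM.
have vC : v 0%N c by apply: vge_sum => j _; apply: (vgeW (leq0n j)).
rewrite (e2_geometric_error nz).
apply: vgeB => //; apply: vge0Ml => //; apply: vge0M; first exact: vge0M.
exact: vgeD.
Qed.

End Filtration.

(** * The sieve *)

Fixpoint polys d : seq {poly 'F_2} :=
  if d is d'.+1 then
    [seq p * 'X | p <- polys d'] ++ [seq p * 'X + 1 | p <- polys d']
  else [:: 0].

Lemma mem_polys d p : (p \in polys d) = (size p <= d)%N.
Proof.
elim: d p => [|d IHd] p; first by rewrite inE leqn0 size_poly_eq0.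
rewrite /= mem_cat; elim/poly_ind: p => [|p c _].
  rewrite size_poly0; apply/orP; left; apply/mapP; exists 0; rewrite ?mul0r //.
  by rewrite IHd size_poly0.
have -> : (size (p * 'X + c%:P)%R <= d.+1)%N = (size p <= d)%N.
  rewrite size_MXaddC; case: ifP => [/andP[/eqP-> _]|_ //].
  by rewrite size_poly0.
rewrite -IHd; apply/orP/idP => [|pd].
  case=> /mapP[q qd /(congr1 (fun r : {poly 'F_2} => r %/ 'X))].
    rewrite divp_addl_mul_small ?size_polyX ?size_polyC ?ltnS ?leq_b1 //.
    by rewrite mulpK ?polyX_eq0 // => ->.
  rewrite !divp_addl_mul_small ?size_polyX ?size_polyC ?size_poly1 ?ltnS
    ?leq_b1 //.
  by move=> ->.
have [->|/F2_neq0->] := eqVneq c 0; [left|right]; apply/mapP; exists p => //.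
by rewrite addr0.
Qed.

Lemma polys_uniq d : uniq (polys d).
Proof.
elim: d => //= d IHd; rewrite cat_uniq !map_inj_uniq ?IHd ?andbT /=.
- apply/hasPn => _ /mapP[p _ ->]; apply/mapP => -[q _].
  move/(congr1 (fun r : {poly 'F_2} => r`_0)).
  by rewrite coefD !coefMX coef1 /= add0r => /eqP; rewrite oner_eq0.
- by move=> p q /addIr/mulIf; apply; rewrite polyX_eq0.
- by move=> p q /mulIf; apply; rewrite polyX_eq0.
Qed.

(** [E], [a] and [E'], [a'] are e_2 and p_1 before and after sieving by p, [EC] and [C1] those of
    the powers of p. Each of the four summands contains a factor known to be small. *)
Fact sieve_algebra (R : comNzRingType) (E a T S EC a' C1 E' : R) :
  E - a ^+ 2 * (T + S) =
    - (EC * a' ^+ 2 + C1 ^+ 2 * E' - E) + a' ^+ 2 * (EC - T * C1 ^+ 2) +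
    C1 ^+ 2 * (E' - a' ^+ 2 * S) + (a + C1 * a') * (T + S) * (C1 * a' - a).
Proof. by ring. Qed.

Section Sieve.
Variables (K : fieldType) (v : filtration K) (phi : {rmorphism {poly 'F_2} -> K}).
Hypothesis charK : 2 \in [pchar K].
Hypothesis phiV : forall p : {poly 'F_2}, p != 0 -> v (size p).-1 (phi p)^-1.
Variables (D m : nat).
Hypothesis m0 : (0 < m)%N.
Implicit Types (p q c : {poly 'F_2}) (ps : seq {poly 'F_2}).

Definition val_inv c : K := phi c ^- m.

Lemma val_invM p q : val_inv (p * q) = val_inv p * val_inv q.
Proof. by rewrite /val_inv rmorphM exprMn invfM. Qed.

Lemma val_invX p k : val_inv (p ^+ k) = val_inv p ^+ k.
Proof. by rewrite /val_inv rmorphXn -!exprVn -!exprM mulnC. Qed.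

Lemma vge_val_inv c : c != 0 -> v (size c).-1 (val_inv c).
Proof.
move=> c0; rewrite /val_inv -exprVn; apply: (@vgeW _ v _ ((size c).-1 * m)).
  by rewrite leq_pmulr.
by apply: vgeX; apply: phiV.
Qed.

(** Over F_2 nonzero polynomials are monic, so [sieved [::]] lists all monic polynomials of degree
    at most D. *)
Definition sieved ps :=
  [seq c <- polys D.+1 | (c != 0) && all (fun p => ~~ (p %| c)) ps].

Definition sieve_values ps := [seq val_inv c | c <- sieved ps].

Lemma mem_sieved ps c : (c \in sieved ps) =
  [&& c != 0, all (fun p => ~~ (p %| c)) ps & (size c <= D.+1)%N].
Proof. by rewrite mem_filter mem_polys andbA. Qed.

Lemma irredp_F2_coprime p q : irreducible_poly p -> irreducible_poly q ->
  p != q -> coprimep p q.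
Proof.
move=> irr_p irr_q; rewrite irreducible_poly_coprime //; apply: contra => pq.
have := irr_q.2 p _ pq; rewrite neq_ltn irr_p.1 orbT => /(_ isT).
have mon (r : {poly 'F_2}) : irreducible_poly r -> r \is monic.
  by move/irredp_neq0 => r0; rewrite monicE;
    rewrite (@F2_neq0 (lead_coef r)) ?lead_coef_eq0 //.
by rewrite eqp_monic ?mon.
Qed.

Lemma irredp_factor p c : irreducible_poly p -> c != 0 ->
  exists k c', c = p ^+ k * c' /\ ~~ (p %| c').
Proof.
move=> irr_p; move: {2}(size c) (leqnn (size c)) => s.
elim: s c => [|s IHs] c; first by rewrite leqn0 size_poly_eq0 => ->.
have [/dvdpP[d ->]|Npc _ _] := boolP (p %| c); last first.
  by exists 0%N, c; rewrite mul1r.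
move=> le_s dp0; have p0 := irredp_neq0 irr_p.
have d0 : d != 0 by apply: contraNneq dp0 => ->; rewrite mul0r.
have [|//|k [c' [-> Npc']]] := IHs d.
  move: le_s irr_p.1; rewrite size_mul //; move: (size d) (size p); lia.
by exists k.+1, c'; split=> //; rewrite mulrC mulrA -exprS.
Qed.

Definition power_multiples ps p : seq {poly 'F_2} :=
  [seq p ^+ j * c | j <- iota 0 D.+1, c <- sieved (rcons ps p)].

(** Each b is uniquely p^k c with c prime to p; k <= D because p^k has degree at least k. *)
Lemma perm_sieved ps p : irreducible_poly p ->
    {in ps, forall q, irreducible_poly q} -> p \notin ps ->
  perm_eq [seq b : {poly 'F_2} <- power_multiples ps p | (size b <= D.+1)%N]
    (sieved ps).
Proof.
move=> irr_p irr_ps Nps; have p0 := irredp_neq0 irr_p.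
apply: uniq_perm; last 1 first; try exact/filter_uniq/polys_uniq.
  move=> b; rewrite mem_filter mem_sieved.
  have cop q k : q \in ps -> coprimep q (p ^+ k).
    move=> qps; apply/coprimep_expr/irredp_F2_coprime => //; first exact: irr_ps.
    by apply: contraNneq Nps => <-.
  apply/andP/and3P => [[le_b /allpairsP[[j c] /= [_]]]|[b0 /allP bps le_b]].
    rewrite mem_sieved all_rcons => /and3P[c0 /andP[_ /allP cps] _ eb].
    split=> //; first by rewrite eb mulf_neq0 ?expf_neq0.
    by apply/allP => q qps; rewrite eb Gauss_dvdpr ?cop ?cps.
  split=> //; have [k [c [eb Npc]]] := irredp_factor irr_p b0.
  have c0 : c != 0 by apply: contraNneq b0 => c0; rewrite eb c0 mulr0.
  have sz : size b = ((size (p ^+ k)).-1 + size c)%N.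
    have : (0 < size (p ^+ k)%R)%N by rewrite lt0n size_poly_eq0 expf_neq0.
    rewrite eb size_mul ?expf_neq0 //; move: (size (p ^+ k)%R) (size c); lia.
  have le_k : (k <= (size (p ^+ k)).-1)%N.
    by rewrite size_exp leq_pmull //; case: (size p) irr_p.1 => [|[]].
  have cgt0 : (0 < size c)%N by rewrite lt0n size_poly_eq0.
  rewrite sz in le_b; apply/allpairsP; exists (k, c); split; last exact: eb.
    rewrite mem_iota add0n ltnS /=; move: le_b le_k cgt0.
    by move: (size (p ^+ k)%R) (size c); lia.
  rewrite mem_sieved c0 all_rcons Npc /=; apply/andP; split; last first.
    by move: le_b; move: (size (p ^+ k)%R) (size c); lia.
  apply/allP => q qps; have := bps q qps.
  by rewrite eb Gauss_dvdpr ?cop.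
apply/filter_uniq/allpairs_uniq;
  [exact: iota_uniq | exact/filter_uniq/polys_uniq |].
have wlog_ji (i j : nat) (c d : {poly 'F_2}) : (i <= j)%N -> ~~ (p %| c) ->
    p ^+ i * c = p ^+ j * d -> i = j /\ c = d.
  move=> le_ij Npc; rewrite -(subnKC le_ij) exprD -mulrA.
  move/(mulfI (expf_neq0 i p0)); case: (j - i)%N => [|k] ec.
    by rewrite addn0 ec mul1r.
  by case/negP: Npc; rewrite ec exprS -mulrA dvdp_mulr.
move=> u w /allpairsP[[i c] [_ cA ->]] /allpairsP[[j d] [_ dA ->]] eq_cd.
move: cA dA eq_cd; rewrite !mem_sieved !all_rcons /= => /and3P[_ /andP[Npc _] _].
case/and3P=> _ /andP[Npd _] _ eq_cd.
have [le_ij|/ltnW le_ji] := leqP i j.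
  by have [-> ->] := wlog_ji _ _ _ _ le_ij Npc eq_cd.
by have [-> ->] := wlog_ji _ _ _ _ le_ji Npd (esym eq_cd).
Qed.

(** The products beyond [A] come from polynomials of degree above D, so they only produce an error
    of order D + 1. *)
Lemma sieve_step ps p : irreducible_poly p ->
    {in ps, forall q, irreducible_poly q} -> p \notin ps ->
  let A := sieve_values ps in let A' := sieve_values (rcons ps p) in
  let C := [seq val_inv p ^+ j | j <- iota 0 D.+1] in
  v D.+1 (\sum_(z <- [seq x * y | x <- C, y <- A']) z - \sum_(x <- A) x) /\
  v D.+1 (e2 [seq x * y | x <- C, y <- A'] - e2 A).
Proof.
move=> irr_p irr_ps Nps A A' C; have := perm_sieved irr_p irr_ps Nps.
set B := power_multiples ps p => permB; have p0 := irredp_neq0 irr_p.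
have -> : [seq x * y | x <- C, y <- A'] = [seq val_inv b | b <- B].
  rewrite map_allpairs allpairs_mapl allpairs_mapr.
  by apply: eq_allpairs => j c; rewrite val_invM val_invX.
have bnz b : b \in B -> b != 0.
  case/allpairsP=> -[j c] /= [_ cA ->].
  by move: cA; rewrite mem_sieved => /and3P[c0 _ _]; rewrite mulf_neq0 ?expf_neq0.
pose small (b : {poly 'F_2}) := (size b <= D.+1)%N.
have eqB : perm_eq (map val_inv B) (A ++ map val_inv (filter (predC small) B)).
  rewrite -(permPl (perm_map _ (permEl (perm_filterC small B)))) map_cat.
  by rewrite perm_cat2r perm_map.
rewrite (perm_big _ eqB) (pairsum_perm (@mulrC _) eqB) /=.
apply: e2_cat_small => _ /mapP[b bB ->].
  move: bB; rewrite mem_sieved => /and3P[b0 _ _].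
  exact: vgeW (leq0n _) (vge_val_inv b0).
move: bB; rewrite mem_filter /= -ltnNge => /andP[lt_b /bnz b0].
apply: vgeW (vge_val_inv b0); rewrite -ltnS prednK //.
exact: leq_trans lt_b.
Qed.

Lemma vge_sieve_values ps x : x \in sieve_values ps -> v 0%N x.
Proof.
case/mapP=> c; rewrite mem_sieved => /and3P[c0 _ _] ->.
exact: vgeW (leq0n _) (vge_val_inv c0).
Qed.

Lemma vge1_val_inv p : irreducible_poly p -> v 1%N (val_inv p).
Proof.
move=> irr_p; apply: vgeW (vge_val_inv (irredp_neq0 irr_p)).
by case: (size p) irr_p.1 => [|[]].
Qed.

Definition prime_term p := val_inv p / (1 - val_inv p).

Lemma vge_prime_term p : irreducible_poly p -> v 0%N (prime_term p).
Proof.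
move=> irr_p; have vx := vge1_val_inv irr_p.
apply: vge0M; first exact: vgeW vx.
by have [] := vge_inv1D (vgeN vx).
Qed.

(** Each prime sieved out takes its [prime_term] from e_2 / p_1^2. At the end at most the polynomial
    1 remains, and e_2 vanishes. *)
Lemma sieve_e2 ps1 ps2 :
    uniq (ps1 ++ ps2) -> {in ps1 ++ ps2, forall q, irreducible_poly q} ->
    (forall c, c != 0 -> (size c <= D.+1)%N ->
       all (fun p => ~~ (p %| c)) (ps1 ++ ps2) -> c = 1) ->
  v D.+1 (e2 (sieve_values ps1) -
    (\sum_(x <- sieve_values ps1) x) ^+ 2 * \sum_(p <- ps2) prime_term p).
Proof.
elim: ps2 ps1 => [|p ps2 IHps] ps1; rewrite ?cats0.
  move=> _ _ only1; rewrite big_nil mulr0 subr0.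
  suff: (size (sieve_values ps1) <= 1)%N.
    by case: sieve_values => [|x []] //= _; rewrite ?big_nil ?addr0; exact: vge0.
  rewrite size_map; suff /uniq_leq_size: {subset sieved ps1 <= [:: 1]}.
    by apply; apply/filter_uniq/polys_uniq.
  by move=> c; rewrite mem_sieved inE => /and3P[c0 cps le_c]; rewrite (only1 c).
rewrite -cat_rcons => uniq_ps irr_ps only1.
have irr_p : irreducible_poly p by apply: irr_ps;
  rewrite mem_cat mem_rcons mem_head.
have [] := @sieve_step ps1 p irr_p.
- by move=> q qps; apply: irr_ps; rewrite mem_cat mem_rcons inE qps orbT.
- by move: uniq_ps; rewrite cat_uniq rcons_uniq => /andP[/andP[]].
have [v1 v2] := geometric_mod charK D.+1 (vge1_val_inv irr_p).
have := IHps _ uniq_ps irr_ps only1.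
set Cs := [seq val_inv p ^+ j | j <- iota 0 D.+1].
have -> (t : seq K) : \sum_(z <- [seq x * y | x <- Cs, y <- t]) z =
    (\sum_(x <- Cs) x) * \sum_(y <- t) y.
  by rewrite big_allpairs_dep -big_distrlr.
have C1E : \sum_(x <- Cs) x = \sum_(j < D.+1) val_inv p ^+ j.
  by rewrite big_map -[iota 0 _]/(index_iota 0 D.+1) big_mkord.
rewrite [\sum_(q <- p ::
  ps2) _]big_cons e2_allpairs -(expr2n_sum charK _ _ _ 1) C1E expn1 -/Cs in v2 *.
set C1 := \sum_(j < _) _ in v1 v2 C1E *; set EC := e2 Cs in v2 *.
rewrite -/(prime_term p) in v2; set T := prime_term p in v2 *;
  set S := \sum_(q <- ps2) _.
have vS : v 0%N S.
  by apply: vge_sum => q qps; apply/vge_prime_term/irr_ps;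
    rewrite mem_cat qps orbT.
have vT : v 0%N T := vge_prime_term irr_p.
have vC1 : v 0%N C1.
  apply: vge_sum => j _; apply: (vgeW (leq0n (1 * j))).
  exact/vgeX/vge1_val_inv.
have va ps : v 0%N (\sum_(x <- sieve_values ps) x) by apply: vge_sum => x;
  apply: vge_sieve_values.
move: (va ps1) (va (rcons ps1 p)).
set a := \sum_(x <- sieve_values ps1) x;
  set a' := \sum_(x <- sieve_values (rcons _ _)) x.
set E := e2 (sieve_values ps1); set E' := e2 (sieve_values (rcons _ _)).
move=> vgea vgea' h1 h2 h3.
have -> : E - a ^+ 2 * (T + S) =
    - (EC * a' ^+ 2 + C1 ^+ 2 * E' - E) + a' ^+ 2 * (EC - T * C1 ^+ 2) +
    C1 ^+ 2 * (E' - a' ^+ 2 * S) + (a + C1 * a') * (T + S) * (C1 * a' - a).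
  exact: sieve_algebra.
have v0X2 x : v 0%N x -> v 0%N (x ^+ 2) by move=> vx; rewrite expr2; apply: vge0M.
apply: vgeD; last first.
  apply: vge0Ml => //; apply: vge0M; apply: vgeD => //; exact: vge0M.
apply: vgeD; last by apply: vge0Ml => //; apply: v0X2.
apply: vgeD; first exact: vgeN.
by apply: vge0Ml => //; apply: v0X2.
Qed.

End Sieve.

(** * Power sums over F_2[t] and part (III) *)

Lemma irredp_divisor (c : {poly 'F_2}) : (1 < size c)%N ->
  exists2 p : {poly 'F_2}, irreducible_poly p & p %| c.
Proof.
move: {2}(size c) (leqnn (size c)) => s; elim: s c => [|s IHs] c.
  by rewrite leqn0 => /eqP->.
move=> le_s gt1; have [irr_c|red_c] := boolp.pselect (irreducible_poly c).
  by exists c.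
have [q [q1 qc Nqc]] : exists q :
  {poly 'F_2}, [/\ size q != 1%N, q %| c & ~~ (q %= c)].
  apply: boolp.contrapT => no_q; apply: red_c; split=> // q q1 qc.
  by apply: boolp.contrapT => /negP Nqc; apply: no_q; exists q.
have c0 : c != 0 by rewrite -size_poly_gt0 ltnW.
have q0 : q != 0 by apply: contraNneq c0 => q0; rewrite -dvd0p -q0.
have lt_qc : (size q < size c)%N.
  by rewrite ltn_neqAle dvdp_leq // andbT dvdp_size_eqp.
have [||p irr_p pq] := IHs q; first by rewrite -ltnS (leq_trans lt_qc).
  by rewrite ltn_neqAle eq_sym q1 size_poly_gt0.
by exists p => //; apply: dvdp_trans qc.
Qed.

Definition nzpolys d : seq {poly 'F_2} := [seq c <- polys d | c != 0].

Lemma mem_nzpolys d c : (c \in nzpolys d) = (c != 0) && (size c <= d)%N.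
Proof. by rewrite mem_filter mem_polys. Qed.

Lemma nzpolys_uniq d : uniq (nzpolys d).
Proof. exact/filter_uniq/polys_uniq. Qed.

Lemma nzpolysS d :
  nzpolys d.+1 = [seq c * 'X | c <- nzpolys d] ++ [seq c * 'X + 1 | c <- polys d].
Proof.
rewrite /nzpolys /= filter_cat !filter_map; congr (_ ++ _).
  by congr map; apply: eq_filter => c /=; rewrite mulf_eq0 polyX_eq0 orbF.
congr map; apply/all_filterP/allP => c _ /=.
by rewrite -size_poly_eq0 size_MXaddC oner_eq0 andbF.
Qed.

Section PartThree.
Variables (K : fieldType) (v : filtration K) (phi : {rmorphism {poly 'F_2} -> K}).
Hypothesis charK : 2 \in [pchar K].
Hypothesis phiV : forall p : {poly 'F_2}, p != 0 -> v (size p).-1 (phi p)^-1.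
Hypothesis phi0 : forall p : {poly 'F_2}, p != 0 -> phi p != 0.
Implicit Types c p : {poly 'F_2}.

Local Notation F n d := (invpsum n (map phi (nzpolys d))).

Lemma phi_inj : injective phi.
Proof.
move=> p q /eqP; rewrite -subr_eq0 -rmorphB => eq0; apply/eqP.
by rewrite -subr_eq0; apply: contraTT eq0 => /phi0.
Qed.

Lemma phi_nzpolys_subspace d : let s := map phi (nzpolys d) in
  [/\ 0 \notin s, uniq s & {in s &, forall x y, x != y -> x + y \in s}].
Proof.
move=> s; split; first by apply/mapP => -[c];
  rewrite mem_nzpolys => /andP[/phi0 + _] e; rewrite -e eqxx.
  by rewrite map_inj_uniq ?nzpolys_uniq //; exact: phi_inj.
move=> _ _ /mapP[b + ->] /mapP[c + ->];
  rewrite !mem_nzpolys => /andP[b0 bd] /andP[c0 cd].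
rewrite (inj_eq phi_inj) => bc; rewrite -rmorphD; apply: map_f.
rewrite mem_nzpolys addr_eq0 (oppr_pchar2 pchar_F2x) bc.
by rewrite (leq_trans (size_polyD _ _)) // geq_max bd.
Qed.

Lemma vge_term n c : (0 < n)%N -> c != 0 -> v (size c).-1 (phi c ^- (2 ^ n - 1)).
Proof.
by move=> n0 c0; apply: (vge_val_inv phiV) => //;
  rewrite subn_gt0 (ltn_exp2l 0 n).
Qed.

Lemma invpsum_truncate n d : (0 < n)%N -> v d (F n d.+1 - F n d).
Proof.
move=> n0; rewrite /invpsum !big_map (bigID (fun c => size c <= d)%N) /=.
rewrite -big_filter -[X in _ - X]big_filter.
rewrite (perm_big (nzpolys d)) /=; last first.
  apply: uniq_perm;
    [exact/filter_uniq/nzpolys_uniq | exact: nzpolys_uniq | move=> c].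
  rewrite mem_filter !mem_nzpolys andbCA; congr (_ && _).
  by case: leqP => // le_cd; rewrite leqW.
rewrite filter_predT addrAC subrr add0r big_seq_cond -big_filter;
  apply: vge_sum => c.
rewrite mem_filter mem_nzpolys -ltnNge => /andP[/andP[/andP[c0 _] lt_dc] _].
by apply: vgeW (vge_term n0 c0); rewrite -ltnS prednK // (leq_trans _ lt_dc).
Qed.

Lemma invpsum_scale n (x : K) s :
  invpsum n (map ( *%R x) s) = x ^- (2 ^ n - 1) * invpsum n s.
Proof.
rewrite /invpsum big_map mulr_sumr; apply: eq_bigr => y _.
by rewrite exprMn invfM.
Qed.

Lemma invpsum_cat n (s t : seq K) :
  invpsum n (s ++ t) = invpsum n s + invpsum n t.
Proof. exact: big_cat. Qed.

(** The polynomials of degree at most d are t {deg < d} and its translate by 1; [invpsum_coset]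
    applies to the latter, whose sum of reciprocals is the difference raised to 2^k. *)
Lemma invpsum_nzpolysS k d : let t := phi 'X in
  F k.+1 d.+1 = t ^- (2 ^ k.+1 - 1) * F k.+1 d +
    (F 1 d.+1 - t^-1 * F 1 d) ^+ (2 ^ k) * F k d.+1.
Proof.
move=> t; pose W := map ( *%R t) (map phi (nzpolys d)).
pose Y := [seq phi (c * 'X + 1) | c <- polys d].
have e : map phi (nzpolys d.+1) = W ++ Y.
  rewrite nzpolysS map_cat -map_comp /W -map_comp -map_comp; congr (_ ++ _).
  by apply: eq_map => c /=; rewrite rmorphM mulrC.
have [s0 us sD] := phi_nzpolys_subspace d.+1.
rewrite e in s0 us sD *; move: (s0) (us); rewrite mem_cat negb_or cat_uniq.
move=> /andP[W0 Y0] /and3P[uW WY uY].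
rewrite (invpsum_cat k.+1) (invpsum_cat 1) !invpsum_scale.
rewrite [t ^- (2 ^ 1 - 1)](_ : _ = t^-1) ?subn1 ?expr1 //.
rewrite [_ + invpsum 1 Y - _]addrAC subrr add0r; congr (_ + _).
apply: invpsum_coset => //.
  move=> _ _ /mapP[_ /mapP[b + ->] ->] /mapP[c + ->].
  rewrite mem_nzpolys mem_polys => /andP[b0 bd] cd.
  apply/mapP; exists (b + c);
    last by rewrite mulrDl -addrA [in RHS]rmorphD rmorphM mulrC.
  by rewrite mem_polys (leq_trans (size_polyD _ _)) // geq_max bd.
move=> _ _ /mapP[b + ->] /mapP[c + ->]; rewrite !mem_polys => bd cd.
have -> : phi (b * 'X + 1) + phi (c * 'X + 1) = t * phi (b + c).
  rewrite -rmorphD addrACA (addrr_pchar2 pchar_F2x) addr0 -mulrDl rmorphM.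
  exact: mulrC.
rewrite (inj_eq phi_inj) (inj_eq (addIr _)) => bc; apply/map_f/map_f.
rewrite mem_nzpolys (leq_trans (size_polyD _ _)) ?geq_max ?bd // andbT.
by rewrite addr_eq0 (oppr_pchar2 pchar_F2x); apply: contraNneq bc => ->.
Qed.

(** The term of c = 1 is 1 and all others lie in the maximal ideal. *)
Lemma invpsum_unit n d : (0 < n)%N -> F n d.+1 != 0 /\ v 0%N (F n d.+1)^-1.
Proof.
move=> n0; rewrite /invpsum big_map (bigD1_seq 1) ?nzpolys_uniq //=; last first.
  by rewrite mem_nzpolys oner_eq0 size_poly1.
rewrite rmorph1 expr1n invr1; apply/vge_inv1D; rewrite -big_filter;
  apply: vge_sum => c.
rewrite mem_filter mem_nzpolys => /and3P[c1 c0 _].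
apply: vgeW (vge_term n0 c0); rewrite -ltnS prednK ?size_poly_gt0 //.
rewrite ltn_neqAle size_poly_gt0 c0 andbT eq_sym.
apply: contraNneq c1 => /eqP/size_poly1P[a a0 ->].
by rewrite (F2_neq0 a0).
Qed.

End PartThree.

(** * Algebraic identities for passing to the limit *)

Section AsymptoticAlgebra.
Variable K : fieldType.
Hypothesis charK : 2 \in [pchar K].
Implicit Types t y s a b c : K.

(** For y = t^(2^k) the left side is [k] / [1]^(2^k). *)
Fact limit_ratioE t y : y != 0 -> 1 + y^-1 != 0 ->
  (y + t) / (y ^+ 2 + y) = (1 + y^-1 + (1 + t / y ^+ 2)) / (1 + y^-1).
Proof.
move=> y0 nz; have ydE : y + 1 = y * (1 + y^-1) by rewrite mulrDr mulfV // mulr1.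
have y1 : y + 1 != 0 by rewrite ydE mulf_neq0.
rewrite addrACA addrr_pchar2 // add0r.
have -> : y ^+ 2 + y = y * (y + 1) by rewrite mulrDr mulr1.
have -> : 1 + y^-1 = (y + 1) / y by rewrite ydE mulrC mulKf.
by field; rewrite y0 y1.
Qed.

(** Rearranges [invpsum_nzpolysS], with [t] and [u] standing for t^-(2^(k+1) - 1) and t^-1: the
    right side involves only differences of consecutive truncations. *)
Fact log_recursion (F F' c c' G t u : K) k :
  F = t * F' + (c - u * c') ^+ (2 ^ k) * G ->
  (1 + t) * F - (1 + u) ^+ (2 ^ k) * (c ^+ (2 ^ k) * G) =
    t * (F' - F) + (u * (c' - c)) ^+ (2 ^ k) * G.
Proof.
have -> : c - u * c' = (1 + u) * c + u * (c' - c).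
  by rewrite subr_char2 //; ring.
rewrite expr2nD // [((1 + u) * c) ^+ _]exprMn => e.
rewrite mulrBr (subr_char2 charK (t * F')) mulrDl mul1r {1}e.
by ring.
Qed.

Fact approx_sqr (F X S R : K) : F != 0 ->
  S - R ^+ 2 =
    (F^-1) ^+ 2 * ((X - F * R) * (X - F * R + F * R + F * R) -
      (X ^+ 2 - F ^+ 2 * S)).
Proof. by move=> F0; field. Qed.

Fact approx_root (F G s u : K) : s != 0 ->
  F + G - F * ((s + u) / s) = - ((u * F - s * G) / s).
Proof. by move=> s0; field. Qed.

End AsymptoticAlgebra.

(** * The sum over primes *)

Section PrimeSum.
Variables (K : fieldType) (v : filtration K) (phi : {rmorphism {poly 'F_2} -> K}).
Hypothesis charK : 2 \in [pchar K].
Hypothesis phiV : forall p : {poly 'F_2}, p != 0 -> v (size p).-1 (phi p)^-1.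
Hypothesis phi0 : forall p : {poly 'F_2}, p != 0 -> phi p != 0.
Variable k : nat.
Local Notation m := (2 ^ k.+1 - 1)%N.

Definition prime_limit : K := phi (brk k) / phi (brk 1) ^+ (2 ^ k).

Definition primes_upto d := [seq p <- polys d | irreducibleb p].

Lemma mem_primes_upto d (p : {poly 'F_2}) :
  reflect (irreducible_poly p /\ (size p <= d)%N) (p \in primes_upto d).
Proof.
by rewrite mem_filter mem_polys; apply: (iffP andP) => -[/irreducibleP].
Qed.

Lemma vge_invpsum n d : v 0%N (invpsum n (map phi (nzpolys d))).
Proof.
rewrite /invpsum big_map; apply: vge_sum => c; rewrite mem_nzpolys => /andP[c0 _].
rewrite -exprVn; apply: vge0X; exact: vgeW (leq0n _) (phiV c0).
Qed.

(** The sieve gives X^2 close to F^2 S, the coset recursion gives X close to F times [prime_limit],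
    and F is a unit. *)
Lemma prime_sum_estimate D :
  v D (\sum_(p <- primes_upto D.+1) prime_term phi m p - prime_limit ^+ 2).
Proof.
have m0 : (0 < m)%N by rewrite subn_gt0 (ltn_exp2l 0 k.+1).
set S := \sum_(p <- _) _.
pose V := map phi (nzpolys D.+1).
have [V0 uV VD] := phi_nzpolys_subspace phi0 D.+1.
have sieved0 : sieved D [::] = nzpolys D.+1 by apply: eq_filter => c /=;
  rewrite andbT.
have e2V : e2 (sieve_values phi D m [::]) = pairX k V ^+ 2.
  rewrite -(e2_invpower charK k V0 uV VD) /sieve_values sieved0 /V.
  by rewrite !pairsum_map.
have p1V : \sum_(x <- sieve_values phi D m [::]) x = invpsum k.+1 V.
  by rewrite /sieve_values sieved0 /invpsum !big_map.
have sieve : v D.+1 (pairX k V ^+ 2 - invpsum k.+1 V ^+ 2 * S).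
  rewrite -e2V -p1V; apply: (sieve_e2 charK phiV) => //=.
  - exact/filter_uniq/polys_uniq.
  - by move=> p /mem_primes_upto[].
  (* A nonconstant c of degree at most D has a prime factor in the list, so only c = 1 survives. *)
  move=> c c0 le_c /allP no_p; have [le1|gt1] := leqP (size c) 1.
    have /size_poly1P[a a0 ->] : size c == 1%N
      by rewrite eqn_leq le1 size_poly_gt0.
    by rewrite (F2_neq0 a0).
  have [p irr_p pc] := irredp_divisor gt1;
    suff: p \in primes_upto D.+1 by move/no_p; rewrite pc.
  by apply/mem_primes_upto; split=> //; apply: leq_trans le_c; apply: dvdp_leq.
set t := phi 'X; have t0 : t != 0 by rewrite phi0 ?polyX_eq0.
have vt : v 1%N t^-1 by have := phiV (negbT (polyX_eq0 _)); rewrite size_polyX.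
have vtm : v 0%N (t ^- m) by rewrite -exprVn; apply/vge0X/(vgeW _ vt).
have [s1_nz vs1] := vge_inv1D vt.
have := invpsum_nzpolysS charK phi0 k D;
  rewrite -/t -/V => /(log_recursion charK).
set F := invpsum k.+1 V; set F1 := invpsum 1 V; set G := invpsum k V.
set s := (1 + t^-1) ^+ (2 ^ k); set sn := 1 + t ^- m;
  set eta := (X in _ = X) => rec.
have veta : v D eta.
  apply: vgeD.
    apply: vge0Ml => //; rewrite -opprB; apply: vgeN; exact: invpsum_truncate.
  apply: vge0Mr; last exact: vge_invpsum.
  apply: (@vgeW _ v _ (D * 2 ^ k)); first by rewrite leq_pmulr ?expn_gt0.
  apply: vgeX; apply: vge0Ml; first exact: (vgeW _ vt).
  by rewrite -opprB; apply: vgeN; apply: invpsum_truncate.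
have s_nz : s != 0 by rewrite expf_neq0.
have vsV : v 0%N s^-1 by rewrite -exprVn; apply: vge0X.
have limE : prime_limit = (s + sn) / s.
  have sE : s = 1 + (t ^+ (2 ^ k))^-1 by rewrite /s (expr2nD charK) expr1n exprVn.
  have snE : sn = 1 + t / (t ^+ (2 ^ k)) ^+ 2.
    by rewrite /sn -(divr_exp2n _ t0) -exprM -expnSr.
  rewrite sE snE -limit_ratioE ?expf_neq0 -?sE // /prime_limit /brk.
  rewrite !rmorphB !rmorphXn expn1 -/t !(subr_char2 charK) (expr2nD charK).
  by rewrite -!exprM mulnC.
have vlim : v 0%N prime_limit.
  rewrite limE; apply: vge0M => //; apply: vgeD.
    by apply: vge0X; apply: vgeD; [exact: vge1 | exact: (vgeW _ vt)].
  by apply: vgeD; [exact: vge1 | exact: vtm].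
have [F_nz vF] : F != 0 /\ v 0%N F^-1 by apply: invpsum_unit.
have XE : pairX k V = F + F1 ^+ (2 ^ k) * G by rewrite pairXE // mulrC.
have vX : v D (pairX k V - F * prime_limit).
  rewrite XE limE approx_root // rec; apply: vgeN; exact: vge0Mr.
have vF0 : v 0%N F := vge_invpsum _ _.
have vFl : v 0%N (F * prime_limit) by apply: vge0M.
rewrite (approx_sqr (pairX k V) S prime_limit F_nz).
apply: vge0Ml; first exact: vge0X.
apply: vgeB; last exact: vgeW (leqnSn D) sieve.
apply: vge0Mr => //; do 2 apply: vgeD => //.
exact: vgeW (leq0n D) vX.
Qed.

Lemma prime_termE (p : {poly 'F_2}) : irreducible_poly p ->
  (1 - phi p ^+ m)^-1 = prime_term phi m p.
Proof.
move/irredp_neq0/phi0 => p0; rewrite /prime_term /val_inv.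
set y := phi p ^+ m; have y0 : y != 0 by rewrite expf_neq0.
have -> : 1 - y^-1 = y^-1 * (y - 1) by rewrite mulrBr mulVf // mulr1.
by rewrite invfM invrK mulKf // -[y - 1]opprB (oppr_pchar2 charK (1 - y)).
Qed.

(** Primes of degree above M contribute only small terms, whichever of them S contains. *)
Lemma prime_sum_limit M (S : seq {poly 'F_2}) :
    uniq S -> {in S, forall p, irreducible_poly p} ->
    {subset primes_upto M.+1 <= S} ->
  v M (\sum_(p <- S) (1 - phi p ^+ m)^-1 - prime_limit ^+ 2).
Proof.
move=> uS irrS subS; have m0 : (0 < m)%N by rewrite subn_gt0 (ltn_exp2l 0 k.+1).
rewrite (eq_big_seq _ (fun p pS => prime_termE (irrS p pS))).
rewrite (bigID (fun p : {poly 'F_2} => size p <= M.+1)%N) /= addrAC.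
rewrite -big_filter (perm_big (primes_upto M.+1)) /=; last first.
  apply: uniq_perm;
    [exact: filter_uniq | exact/filter_uniq/polys_uniq | move=> p].
  rewrite mem_filter;
    apply/andP/mem_primes_upto => [[le_p /irrS] //|[irr_p le_p]].
  by split=> //; apply/subS/mem_primes_upto.
apply: vgeD; first exact: prime_sum_estimate.
rewrite -big_filter; apply: vge_sum => p;
  rewrite mem_filter -ltnNge => /andP[lt_p pS].
have irr_p := irrS p pS; have vx := vge1_val_inv phiV m0 irr_p.
have [_ v1x] := vge_inv1D (vgeN vx).
apply: vge0Mr => //; apply: vgeW (vge_val_inv phiV m0 (irredp_neq0 irr_p)).
by rewrite -ltnS prednK; apply: leq_trans lt_p => //; rewrite leqnSn.
Qed.

End PrimeSum.

(** * Roots of additive polynomials *)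

Section RootsOfAdditivePolynomials.
Variable K : closedFieldType.
Hypothesis charK : 2 \in [pchar K].
Variables (eps : nat -> K) (b : nat).
Hypothesis eps0 : eps 0%N = 1.
Hypothesis b0 : (0 < b)%N.

Definition mersenne_poly : {poly K} := \sum_(k < b) eps k *: 'X^(2 ^ k - 1).

Local Notation E := mersenne_poly.

Lemma coef_mersenne_poly j :
  E`_j = \sum_(k < b) (j == 2 ^ k - 1)%N%:R * eps k.
Proof.
by rewrite coef_sum; apply: eq_bigr => k _; rewrite coefZ coefXn mulrC.
Qed.

Lemma mersenne_poly_coef0 : E`_0 = 1.
Proof.
rewrite coef_mersenne_poly (bigD1 (Ordinal b0)) //= eps0 mulr1 big1 ?addr0 //
  => k.
rewrite -val_eqE /= => k0; rewrite eq_sym subn_eq0 leqNgt.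
by rewrite (ltn_exp2l 0 k) // lt0n k0 mul0r.
Qed.

Lemma mersenne_polyX : 'X * E = \sum_(k < b) eps k *: 'X^(2 ^ k).
Proof.
rewrite mulr_sumr; apply: eq_bigr => k _.
by rewrite -scalerAr -exprS -addn1 subnK ?expn_gt0.
Qed.

Lemma mersenne_polyX_additive x y :
  ('X * E).[x + y] = ('X * E).[x] + ('X * E).[y].
Proof.
rewrite mersenne_polyX !horner_sum -big_split; apply: eq_bigr => k _ /=.
by rewrite !hornerE expr2nD // mulrDr.
Qed.

(** The exponents 2^k with k > 0 are even, so the derivative is [eps 0] = 1. *)
Lemma mersenne_polyX_separable : separable_poly ('X * E).
Proof.
rewrite mersenne_polyX unlock.
have -> : (\sum_(k < b) eps k *: 'X^(2 ^ k))^`() = 1.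
  rewrite raddf_sum (bigD1 (Ordinal b0)) //= derivZ derivX eps0 scale1r.
  rewrite big1 ?addr0 // => k; rewrite -val_eqE /= => k0.
  rewrite derivZ derivXn -mulr_natl natrX -polyC1 -polyCMn (pcharf0 charK).
  by rewrite polyC0 expr0n (negPf k0) mul0r scaler0.
exact: coprimep1.
Qed.

(** X E is additive and separable, so its roots are distinct and form a group; E(0) = 1 normalizes
    the factorization. *)
Lemma mersenne_poly_roots : exists s : seq K,
  [/\ [/\ 0 \notin s, uniq s & {in s &, forall x y, x != y -> x + y \in s}],
      (size s).+1 = size E
    & \prod_(x <- map GRing.inv s) (1 + x *: 'X) = E].
Proof.
have E0 : E != 0.
  by apply: contra_eq_neq mersenne_poly_coef0 => ->;
    rewrite coef0 eq_sym oner_eq0.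
have [s defE] := closed_field_poly_normal E.
have lc0 : lead_coef E != 0 by rewrite lead_coef_eq0.
have rE x : root E x = (x \in s) by rewrite defE rootZ // root_prod_XsubC.
have s0 : 0 \notin s.
  by rewrite -rE rootE horner_coef0 mersenne_poly_coef0 oner_eq0.
have nz x : x \in s -> x != 0 by move=> xs; apply: contraNneq s0 => <-.
exists s; split.
- split=> //.
    have := mersenne_polyX_separable; rewrite separable_mul => /and3P[_ + _].
    rewrite defE -mul_polyC separable_mul => /and3P[_ + _].
    by rewrite separable_prod_XsubC.
  move=> x y xs ys xy; rewrite -rE.
  have xy0 : x + y != 0 by rewrite addr_eq0_pchar2.
  have r z : z \in s -> ('X * E).[z] = 0.
    by rewrite -rE hornerM => /rootP->; rewrite mulr0.
  have := mersenne_polyX_additive x y;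
    rewrite (r x xs) (r y ys) addr0 hornerM hornerX.
  by move/eqP; rewrite mulf_eq0 (negPf xy0).
- by rewrite defE size_scale // size_prod_XsubC.
rewrite big_map [RHS]defE.
have -> : \prod_(x <- s) (1 + x^-1 *: 'X) =
    (\prod_(x <- s) (- x)^-1) *: \prod_(x <- s) ('X - x%:P).
  rewrite -mul_polyC rmorph_prod -big_split /=; apply: eq_big_seq => x /nz x0.
  rewrite mulrBr -polyCM (oppr_pchar2 charK) mulVf // mul_polyC subr_char2.
    by rewrite addrC.
  by rewrite pchar_poly.
congr (_ *: _); apply: (@mulIf _ (\prod_(x <- s) - x)).
  by rewrite prodf_seq_neq0; apply/allP => x /nz; rewrite /= oppr_eq0.
rewrite -big_split /= big1_seq; last first.
  by move=> x /andP[_ /nz x0]; rewrite mulVf // oppr_eq0.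
rewrite -[LHS]mersenne_poly_coef0 -horner_coef0 {1}defE hornerZ horner_prod.
by congr (_ * _); apply: eq_bigr => x _; rewrite hornerXsubC sub0r.
Qed.

(** The value at 0 is f_0 = 1, whereas [invpsum 0 s] counts the elements of s. *)
Definition recpsum (s : seq K) n := if n is 0 then 1 else invpsum n s.

(** Newton's identities make [recpsum s] a right twisted inverse of [eps]; the recursion says that
    it is also a left inverse. *)
Lemma recpsum_recursion s :
    \prod_(x <- map GRing.inv s) (1 + x *: 'X) = E ->
    (forall k, (b <= k)%N -> eps k = 0) ->
  recpsum s 1 = eps 1%N /\
  forall n, recpsum s n.+1 =
    - \sum_(k < n.+1) recpsum s k * eps (n.+1 - k)%N ^+ (2 ^ k).
Proof.
move=> defE epsb; have new := newton_mersenne charK eps0 epsb defE.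
have fE n : (0 < n)%N -> mpsum (map GRing.inv s) n = recpsum s n.
  case: n => // n _; rewrite /mpsum big_map; apply: eq_bigr => x _.
  by rewrite exprVn.
have tw n : twmul eps (recpsum s) n.+1 = 0.
  rewrite /twmul big_ord_recr /= subnn expr1n mulr1 addrC -[RHS](new n).
  by congr (_ + _); apply: eq_bigr => k _; rewrite fE // subn_gt0.
split.
  have := new 0%N; rewrite big_ord1 eps0 mul1r expr1 fE // => /eqP.
  by rewrite addr_eq0_pchar2 // => /eqP.
move=> n; have /eqP := twmul_inv charK eps0 (erefl : recpsum s 0 = 1) tw n.
rewrite /twmul big_ord_recr /= subnn eps0 expr1n mulr1 addrC addr_eq0 => /eqP//.
Qed.

Lemma pairX_Xpoly s : 
    [/\ 0 \notin s, uniq s & {in s &, forall x y, x != y -> x + y \in s}] ->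
    (size s).+1 = size E ->
    \prod_(x <- map GRing.inv s) (1 + x *: 'X) = E ->
    (forall k, (b <= k)%N -> eps k = 0) ->
  forall k, pairX k s = Xpoly eps k.+1.
Proof.
move=> [s0 us sD] sz defE epsb k; have [f1 fS] := recpsum_recursion defE epsb.
rewrite (XpolySE charK (erefl : recpsum s 0 = 1) fS) -f1 pairXE //.
(* Only k = 0 remains, comparing [invpsum 0 s] with f_0 = 1. If s is nonempty, its size is the
   degree of E, of the form 2^k - 1, hence odd; otherwise the other factor is zero. *)
congr (_ + _); case: k => // ; rewrite expr1 /=.
have [->|s_nnil] := eqVneq s [::]; first by rewrite /invpsum !big_nil !mulr0.
congr (_ * _); rewrite /invpsum.
have : E`_(size s) != 0.
  have -> : size s = (size E).-1 by rewrite -sz.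
  by rewrite -/(lead_coef E) lead_coef_eq0 -size_poly_gt0 -sz.
rewrite coef_mersenne_poly => nzE.
have [k szk] : exists k, size s = (2 ^ k - 1)%N.
  apply: boolp.contrapT => no_k; case/eqP: nzE; apply: big1 => k _.
  by case: eqP => [szk|_]; [case: no_k; exists k | rewrite mul0r].
case: k szk => [/size0nil/eqP|k szk]; first by rewrite (negPf s_nnil).
rewrite (eq_bigr (fun=> 1)) => [|x _]; last by rewrite subnn invr1.
rewrite big_const_seq count_predT iter_addr_0 szk natrB ?expn_gt0 //.
by rewrite natrX (pcharf0 charK) expr0n sub0r oppr_pchar2.
Qed.

End RootsOfAdditivePolynomials.

(** * Specialization of polynomials and part (I) *)

Section MultivariateEvaluation.

Lemma mmap_comp_mpoly (R : comNzRingType) (S : comNzRingType) (N k : nat)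
    (f : {rmorphism R -> S}) (x : 'I_k -> S) (t : N.-tuple {mpoly R[k]}) p :
  mmap f x (p \mPo t) = mmap f (fun i => mmap f x (tnth t i)) p.
Proof.
rewrite comp_mpolyEX [RHS]/mmap raddf_sum; apply: eq_bigr => m _ /=.
rewrite mmapZ comp_mpolyX rmorph_prod; congr (_ * _).
by apply: eq_bigr => i _; rewrite rmorphXn.
Qed.

Lemma mmap_map_mpoly (R1 R2 S : comNzRingType) (N : nat) (f : {rmorphism R1 ->
  R2})
    (g : {rmorphism R2 -> S}) (x : 'I_N -> S) p :
  mmap g x (map_mpoly f p) = mmap (g \o f) x p.
Proof.
rewrite {1}/map_mpoly [X in mmap g x X]/mmap raddf_sum; apply: eq_bigr => m _ /=.
rewrite mmap1_id mul_mpolyC mmapZ mmapX //.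
Qed.

Lemma mmap_mesym (R S : comNzRingType) (N j : nat) (f : {rmorphism R -> S})
    (x : 'I_N -> S) :
  mmap f x (mesym N R j) = (\prod_(i < N) (1 + x i *: 'X))`_j.
Proof.
under eq_bigr => i _ do rewrite addrC.
rewrite bigA_distr coef_sum /mesym raddf_sum [LHS]big_mkcond /=.
apply: eq_bigr => J _; rewrite -big_mkcond /= rmorph_prod /=.
under eq_bigr => i _ do rewrite mmapX mmap1U.
rewrite scaler_prod coefZ prodr_const coefXn eq_sym.
by case: eqP; rewrite ?mulr1 ?mulr0.
Qed.

Lemma digits_inj B N (a b : 'I_N -> nat) :
    (forall i, a i < B)%N -> (forall i, b i < B)%N ->
    (\sum_i a i * B ^ i = \sum_i b i * B ^ i)%N -> a =1 b.
Proof.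
elim: N a b => [|N IHN] a b ltaB ltbB; first by move=> _ [].
rewrite !big_ord_recl /= !expn0 !muln1.
have shift (c : 'I_N.+1 -> nat) : (\sum_(i < N) c (lift ord0 i) * B ^ bump 0 i =
    B * \sum_(i < N) c (lift ord0 i) * B ^ i)%N.
  by rewrite big_distrr /=; apply: eq_bigr => i _; rewrite expnS mulnCA.
rewrite !shift => e; have B0 : (0 < B)%N := leq_ltn_trans (leq0n _) (ltaB ord0).
have e0 : a ord0 = b ord0.
  have := congr1 (modn^~ B) e; rewrite ![(_ + B * _)%N]addnC ![(B * _)%N]mulnC.
  by rewrite !modnMDl !modn_small.
move: e; rewrite e0 => /addnI/eqP; rewrite eqn_pmul2l // => /eqP/IHN eqS i.
by case: (unliftP ord0 i) => [j|] -> //; apply: eqS.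
Qed.

(* Kronecker substitution 'X_i := t^(B^i) with B larger than all exponents.   *)
Lemma mpoly_eq0_closed_field (R : fieldType) (K : closedFieldType)
    (h : {rmorphism R -> K}) (N : nat) (p : {mpoly R[N]}) :
  (forall x : 'I_N -> K, mmap h x p = 0) -> p = 0.
Proof.
move=> p0; apply/mpolyP => m; rewrite mcoeff0; apply/eqP.
have [m_p|] := boolP (m \in msupp p); last by rewrite mcoeff_msupp negbK.
pose B := msize p; pose wt (l : 'X_{1..N}) := (\sum_i l i * B ^ i)%N.
pose q : {poly K} := \sum_(l <- msupp p) h p@_l *: 'X^(wt l).
have q0 x : q.[x] = 0.
  rewrite -[RHS](p0 (fun i => x ^+ (B ^ i))) /mmap horner_sum;
    apply: eq_bigr => l _.
  rewrite !hornerE; congr (_ * _); rewrite /mmap1 -prodrXr; apply: eq_bigr => i _.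
  by rewrite -exprM mulnC.
have qE : q = 0.
  (* q + 1 takes only the value 1, so it has no root and must be constant. *)
  have : ~~ (size (q + 1) != 1%N).
    apply/negP => /closed_rootP[x]; rewrite rootE hornerD q0 hornerC add0r.
    by rewrite oner_eq0.
  rewrite negbK => /size_poly1P[c _ qc]; have qC : q = (c - 1)%:P.
    by rewrite polyCB -qc polyC1 addrK.
  by have := q0 0; rewrite qC hornerC => ->; rewrite polyC0.
have ltB l i : l \in msupp p -> (l i < B)%N.
  move=> l_p; apply: leq_ltn_trans (msize_mdeg_lt l_p).
  by rewrite mdegE (bigD1 i) //= leq_addr.
have /eqP := congr1 (fun r : {poly K} => r`_(wt m)) qE.
rewrite coef0 coef_sum (bigD1_seq m) ?msupp_uniq //= coefZ coefXn eqxx mulr1.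
rewrite big_seq_cond big1 => [|l /andP[l_p lm]];
  first by rewrite addr0 fmorph_eq0.
rewrite coefZ coefXn; case: eqP => [e|_]; last by rewrite mulr0.
case/negP: lm; apply/eqP/mnmP => i; apply/esym; move: i.
by apply: (digits_inj (B := B)) => // i; apply: ltB.
Qed.

End MultivariateEvaluation.

Section SymmetricExpression.

Lemma psum_sym N m : psum N m \is symmetric.
Proof.
apply/issymP => s; rewrite /psum raddf_sum [RHS](reindex_inj (@perm_inj _ s)) /=.
by apply: eq_bigr => i _; rewrite rmorphXn /= [msym s 'X_i]mmapX mmap1U.
Qed.

(** Twice G is symmetric, and integer polynomials have no 2-torsion. *)
Lemma Gpoly_sym N n : Gpoly N n \is symmetric.
Proof.
apply/issymP => s; apply/eqP.
have two0 : (2%:R : {mpoly int[N]}) != 0.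
  by rewrite -mpolyC_nat mpolyC_eq0.
rewrite -(inj_eq (mulIf two0)) !mulr_natr -msymMn Gpoly_double.
rewrite msymB; apply/eqP; congr (_ - _); last exact/issymP/psum_sym.
by rewrite rmorphXn /=; congr (_ ^+ _); apply/issymP/psum_sym.
Qed.

Lemma Gpoly_expressed N n : exists! P, expresses P (Gpoly N n).
Proof.
have [P [PG _]] := sym_fundamental (Gpoly_sym N n).
exists P; split=> // P' P'G; apply: (@msym_fundamental_un N int).
by rewrite PG -P'G.
Qed.

End SymmetricExpression.

(** Only positive indices are compared: [eps_var N 0] is 0 but [eps_at] has value 1 at 0. *)
Lemma Xpoly_rmorph (R S : comNzRingType) (f : {rmorphism R -> S})
    (eps : nat -> R) (eps' : nat -> S) n :
  (forall k, (0 < k)%N -> f (eps k) = eps' k) -> f (Xpoly eps n) = Xpoly eps' n.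
Proof.
move=> feps.
have Xf j : (forall i, (i < j)%N -> f (fpoly eps i) = fpoly eps' i) ->
    f (Xpoly eps j) = Xpoly eps' j.
  case: j => [_|j ff]; first exact: rmorph1.
  rewrite !XpolyE // /Xformula rmorph_sum; apply: eq_bigr => i _.
  rewrite rmorphM rmorphXn feps ?ff ?subn_gt0 //.
    exact: leq_trans (ltn_ord i) _.
  exact: leq_trans (ltn_ord i) _.
have ff j i : (i < j)%N -> f (fpoly eps i) = fpoly eps' i.
  elim: j i => // j IHj i; rewrite ltnS leq_eqVlt => /predU1P[->|/IHj //].
  case: j IHj => [_|j IHj]; first exact: rmorph1.
  by rewrite !fpolyS rmorphD rmorphM rmorphXn feps // Xf // IHj.
by apply: Xf => i _; apply: (ff i.+1).
Qed.

Lemma fpoly_expand (R : comNzRingType) (eps : nat -> R) k :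
  fpoly eps k =
    \sum_(j < k.+1) eps 1%N ^+ (\sum_(j <= i < k) 2 ^ i) * Xpoly eps j.
Proof.
elim: k => [|k IHk]; first by rewrite big_ord1 big_geq // mulr1.
rewrite fpolyS big_ord_recr /= big_geq // mul1r; congr (_ + _).
rewrite IHk mulr_suml; apply: eq_bigr => j _.
by rewrite big_nat_recr -1?ltnS //= exprD mulrAC.
Qed.

Lemma exp2B1_inj : injective (fun k => 2 ^ k - 1)%N.
Proof.
move=> j k /(congr1 succn); rewrite !subn1 !prednK ?expn_gt0 // => /eqP.
by rewrite eqn_exp2l // => /eqP.
Qed.

(** * Evaluation of Y and X at a point of an algebraically closed field *)

Section EvaluationOfY.
Variable K : closedFieldType.
Hypothesis charK : 2 \in [pchar K].
Variables (h : {rmorphism 'F_2 -> K}) (N : nat) (w : 'I_N -> K).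

Definition eps_at k : K :=
  if k is 0 then 1 else \sum_(i < N | i.+1 == (2 ^ k - 1)%N) w i.

Definition mersenne_part (i : 'I_N) : K := if mersenne i.+1 then w i else 0.

Lemma leq_exp2B1 k : (k <= 2 ^ k - 1)%N.
Proof. by rewrite -ltnS subn1 prednK ?expn_gt0 // ltn_expl. Qed.

Lemma eps_at_out k : (N < 2 ^ k - 1)%N -> eps_at k = 0.
Proof.
case: k => // k lt_N; apply: big1 => i /eqP e.
by move: (ltn_ord i); rewrite -e ltnNge in lt_N *; rewrite (negPf lt_N).
Qed.

Lemma coef_eps_at (i : 'I_N) :
  (mersenne_poly eps_at N.+1)`_i.+1 = mersenne_part i.
Proof.
rewrite coef_mersenne_poly /mersenne_part;
  case: ifP => [/existsP[k /eqP ek]|no_k].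
  have lt_kN : (k < N.+1)%N.
    by rewrite ltnS (leq_trans (leq_exp2B1 k)) // -ek.
  rewrite (bigD1 (Ordinal lt_kN)) //= -ek eqxx mul1r [X in _ + X]big1 ?addr0;
    last first.
    move=> j; rewrite -val_eqE /= => jk; rewrite (_ : _ == _ = false) ?mul0r //.
    apply: contraNF jk => /eqP e; apply/eqP/exp2B1_inj.
    exact: etrans (esym e) ek.
  case: (nat_of_ord k) ek => // k' ek; rewrite /eps_at -ek.
  by rewrite (big_pred1 i) // => j; rewrite eqSS.
apply: big1 => k _; case: eqP => [e|_]; last by rewrite mul0r.
have lt_k : (k < i.+2)%N by rewrite ltnS e leq_exp2B1.
by case/negP: (negbT no_k); apply/existsP; exists (Ordinal lt_k); apply/eqP.
Qed.

Lemma size_mersenne_poly_eps_at : (size (mersenne_poly eps_at N.+1) <= N.+1)%N.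
Proof.
apply/leq_sizeP => j lt_Nj; rewrite coef_mersenne_poly; apply: big1 => k _.
by case: eqP => [e|_]; [rewrite eps_at_out ?mulr0 // -e | rewrite mul0r].
Qed.

(** The point x consists of the inverse roots of [mersenne_poly], so its elementary symmetric
    functions of non-Mersenne index vanish, and [e2_invpower] computes G there. *)
Lemma eval_Gpoly n : exists2 x : 'I_N -> K,
    forall i : 'I_N, mmap (intr : int -> K) x (mesym N int i.+1) = mersenne_part i
  & mmap (intr : int -> K) x (Gpoly N n.+1) = Xpoly eps_at n.+1 ^+ 2.
Proof.
have [s [subs sz defE]] := @mersenne_poly_roots K charK eps_at N.+1 erefl isT.
have sN : (size s <= N)%N by rewrite -ltnS sz size_mersenne_poly_eps_at.
(* Zeros fill up the N variables; they change neither the product of the 1 + xX nor e_2. *)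
pose xs := map GRing.inv s ++ nseq (N - size s) 0.
have szx : size xs = N by rewrite size_cat size_map size_nseq subnKC.
exists (fun i => nth 0 xs i) => [i|].
  rewrite mmap_mesym -coef_eps_at -defE; congr (nth _ (polyseq _) _).
  transitivity (\prod_(x <- xs) (1 + x *: 'X)).
    by rewrite (big_nth 0) szx big_mkord.
  rewrite big_cat /= [X in _ * X]big1_seq ?mulr1 // => x /andP[_].
  by rewrite mem_nseq => /andP[_ /eqP->]; rewrite scale0r addr0.
have epsb k : (N < k)%N -> eps_at k = 0.
  by move=> lt_Nk; rewrite eps_at_out // (leq_trans lt_Nk) ?leq_exp2B1.
rewrite -(pairX_Xpoly charK _ subs sz defE epsb) //; case: subs => s0 us sD.
rewrite -(e2_invpower charK n s0 us sD).
set m := (2 ^ n.+1 - 1)%N;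
  have m0 : (0 < m)%N by rewrite subn_gt0 (ltn_exp2l 0 n.+1).
transitivity (pairsum (fun x y : K => x ^+ m * y ^+ m) xs).
  rewrite (pairsum_nth 0) szx /Gpoly rmorph_sum; apply: eq_bigr => i _.
  rewrite rmorph_sum; apply: eq_bigr => j _.
  by rewrite rmorphM !rmorphXn /= !mmapX !mmap1U.
rewrite pairsum_cat pairsum_map.
have -> : pairsum (fun x y : K => x ^+ m * y ^+ m) (nseq (N - size s) 0) = 0.
  elim: (_ - _)%N => //= l ->; rewrite addr0 big1 // => y _.
  by rewrite expr0n eqn0Ngt m0 mul0r.
rewrite addr0 [X in _ + X]big1 ?addr0 => [|x _].
  by apply: eq_in_pairsum => // x y _ _ _; rewrite !exprVn.
rewrite big1_seq // => y /andP[_]; rewrite mem_nseq => /andP[_ /eqP->].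
by rewrite expr0n eqn0Ngt m0 mulr0.
Qed.

(** Discarding monomials amounts to setting the variables of non-Mersenne index to 0. *)
Lemma eval_Ypoly (P : {mpoly int[N]}) :
  mmap h w (Ypoly P) = mmap (intr : int -> K) mersenne_part P.
Proof.
transitivity (mmap h mersenne_part (map_mpoly (intr : int -> 'F_2) P));
  last first.
  rewrite mmap_map_mpoly; apply: eq_bigr => m _; congr (_ * _).
  exact: rmorph_int.
rewrite /Ypoly raddf_sum /= [RHS]/mmap big_mkcond; apply: eq_bigr => m _.
case: ifP => [mers|/negbT].
  rewrite mmapZ mmapX; congr (_ * _); apply: eq_bigr => i _.
  have [->//|mi0] := eqVneq (m i) 0%N.
  by rewrite /mersenne_part (implyP (forallP mers i)).
case/forallPn => i; rewrite negb_imply => /andP[mi0 Ni].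
by rewrite /mmap1 (bigD1 i) //= /mersenne_part (negPf Ni) expr0n (negPf mi0)
  mul0r mulr0.
Qed.

Lemma eval_Xpoly n : mmap h w (Xpoly (eps_var N) n) = Xpoly eps_at n.
Proof.
apply: Xpoly_rmorph => -[//|k] _; rewrite /= raddf_sum.
by apply: eq_bigr => i _; rewrite /= mmapX mmap1U.
Qed.

End EvaluationOfY.

Lemma Ypoly_square N n (P : {mpoly int[N]}) :
  expresses P (Gpoly N n.+1) -> Ypoly P = Xpoly (eps_var N) n.+1 ^+ 2.
Proof.
move=> PG; have [K [h _]] := countable_algebraic_closure 'F_2.
have charK : 2 \in [pchar K] by apply: (rmorph_pchar h); rewrite pchar_Fp.
apply/eqP; rewrite -subr_eq0; apply/eqP;
  apply: (mpoly_eq0_closed_field (h := h)) => w.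
have eX (q : {mpoly 'F_2[N]}) : mmap h w (q ^+ 2) = mmap h w q ^+ 2.
  exact: rmorphXn.
rewrite mmapB eX eval_Ypoly eval_Xpoly.
have [x xE <-] := eval_Gpoly charK w n.
rewrite -PG mmap_comp_mpoly; apply/eqP; rewrite subr_eq0; apply/eqP.
apply: eq_bigr => m _; congr (_ * _); apply: eq_bigr => i _.
by rewrite tnth_mktuple xE.
Qed.

Theorem mainTheorem1 (n : nat) (hn : (1 <= n)%N) :
  (* (I) *)
  (forall N : nat, (2 * (2 ^ n - 1) <= N)%N ->
     [/\ exists! P : {mpoly int[N]}, expresses P (Gpoly N n),
         forall P : {mpoly int[N]}, expresses P (Gpoly N n) ->
           Ypoly P = Xpoly (eps_var N) n ^+ 2
       & Xpoly (eps_var N) n =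
           \sum_(k < n.-1) eps_var N (n - k) ^+ (2 ^ k) *
             \sum_(j < k.+1)
               eps_var N 1 ^+ (\sum_(j <= i < k) 2 ^ i) * Xpoly (eps_var N) j])
  (* (II) *)
  /\ (Xformula (fun i => (Dfrac i)^-1) (fun i => (Lfrac i)^-1) n = A_ n
      /\ \sum_(k < n.-1) (Dfrac (n - k) ^+ (2 ^ k) * Lfrac k)^-1 = A_ n)
  (* (III) *)
  /\ has_sumL (fun p : {poly 'F_2} => irreducible_poly p /\ p \is monic)
       (fun p => (1 - toL p ^+ (2 ^ n - 1))^-1)
       (toL (brk n.-1) ^+ 2 / toL (brk 1) ^+ (2 ^ n)).
Proof.
split; [|split].
- move=> N _; split.
  + exact: Gpoly_expressed.
  + by case: n hn => // n _ P; apply: Ypoly_square.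
  rewrite XpolyE //; apply: eq_bigr => k _; congr (_ * _); exact: fpoly_expand.
- split; last exact: carlitz_A.
  rewrite -carlitz_A //; apply: eq_bigr => k _.
  by rewrite invfM exprVn.
case: n hn => // k _ M.
have monic_irredp (p : {poly 'F_2}) : irreducible_poly p -> p \is monic.
  by move/irredp_neq0 => p0;
    rewrite monicE (@F2_neq0 (lead_coef p)) ?lead_coef_eq0.
(* The primes of degree at most M already give precision M. *)
exists [fset p in primes_upto M.+1]%fset; split.
  by move=> p; rewrite inE => /mem_primes_upto[irr_p _]; split=> //;
    apply: monic_irredp.
move=> S irrS /fsubsetP subS.
have -> : toL (brk k.+1.-1) ^+ 2 / toL (brk 1) ^+ (2 ^ k.+1) =
    prime_limit toL k ^+ 2.
  by rewrite /prime_limit exprMn exprVn -exprM -expnSr.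
apply: (@prime_sum_limit _ laurent_filtration toL pchar_F2L) => //.
- exact: lvge_toLV.
- exact: toL_neq0.
- exact: fset_uniq.
- by move=> p /irrS[].
by move=> p p_in; apply: subS; rewrite inE.
Qed.
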